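(* Let $\varphi:\mathbb{D}\to\mathbb{C}$ be an analytic univalent function with positive real part in $\mathbb{D}$, with $\varphi(0)=1$, $\varphi'(0)>0$ and $\varphi''(0)\in\mathbb{R}$, and write $\varphi(z)=1+B_1z+B_2z^2+\cdots$. Suppose that $0<B_1\le |B_2+B_1^2|$. Then every $f\in\mathcal{S}^*(\varphi)$ satisfies $$|T_2(2)|\le \frac14\,(B_2+B_1^2)^2+B_1^2,$$ where $T_2(2)$ is the Toeplitz determinant of $f$. The bound is sharp, i.e. for each such $\varphi$ there is a function $f\in\mathcal{S}^*(\varphi)$ for which equality holds.
   Context: $\mathbb{D}$ is the open unit disk in $\mathbb{C}$. $\mathcal{A}$ is the class of analytic functions $f:\mathbb{D}\to\mathbb{C}$ with Taylor series $f(z)=z+\sum_{n\ge2}a_nz^n$, and $\mathcal{S}\subset\mathcal{A}$ is the subclass of univalent (one-to-one) functions. For analytic functions $g,F$ on $\mathbb{D}$, $g$ is subordinate to $F$, written $g\prec F$, if there is an analytic $w:\mathbb{D}\to\mathbb{D}$ with $w(0)=0$ such that $g(z)=F(w(z))$ for all $z\in\mathbb{D}$. The class $\mathcal{S}^*(\varphi)$ is $$\mathcal{S}^*(\varphi):=\left\{f\in\mathcal{S}:\ \frac{zf'(z)}{f(z)}\prec\varphi(z)\right\}.$$ (The quotient $zf'(z)/f(z)$ is given the value $1$ at $z=0$.) For $f(z)=z+\sum_{n\ge2}a_nz^n$, $T_q(n)$ denotes the determinant of the $q\times q$ symmetric Toeplitz matrix whose $(i,j)$ entry is $a_{n+|i-j|}$;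 in particular $T_2(2)=\begin{vmatrix} a_2 & a_3 \\ a_3 & a_2 \end{vmatrix}$, so $|T_2(2)|=|a_3^2-a_2^2|$. *)

(* Defs.v *)
From HB Require Import structures.
From mathcomp Require Import all_boot all_order all_algebra.
From mathcomp Require Import complex.
From mathcomp Require Import all_classical all_reals all_analysis.

Set Implicit Arguments.
Unset Strict Implicit.
Unset Printing Implicit Defensive.

Import Order.TTheory GRing.Theory Num.Theory.
Import numFieldNormedType.Exports.

Local Open Scope ring_scope.
Local Open Scope complex_scope.
Local Open Scope classical_set_scope.

(* The complex numbers are R[i] for R : realType. R[i] is a numFieldType, so
   it is a normed module over itself, and derivable f z 1 and derive1 f are complex
   differentiability and the complex derivative.
   The order of R[i] is partial: x <= y means that x and y have equal imaginary
   parts and that Re x <= Re y; in particular 0 < x says that x is real and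
   positive. The norm `|z| is the modulus, as an element of R[i].
   Functions on the disk are total functions on R[i], of which only the values
   on the disk are constrained or used. *)

(* The norm topology on R[i], which the libraries do not declare. *)
HB.instance Definition _ (R : realType) := NormedModule.copy R[i] (R[i] : numFieldType)^o.

Section ComplexDisk.
Variable R : realType.
Implicit Types (f g F w phi : R[i] -> R[i]) (n q : nat).

Definition unit_disk : set R[i] := [set z | `|z| < 1].

Definition analytic_on_disk f : Prop :=
  forall z, unit_disk z -> derivable f z 1.

Definition univalent_on_disk f : Prop :=
  forall z1 z2, unit_disk z1 -> unit_disk z2 -> f z1 = f z2 -> z1 = z2.

Definition taylor_coef f n : R[i] := derive1n n f 0 / n`!%:R.

Definition class_A f : Prop :=
  [/\ analytic_on_disk f, taylor_coef f 0 = 0 & taylor_coef f 1 = 1].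

Definition class_S f : Prop := class_A f /\ univalent_on_disk f.

Definition subordinate g F : Prop :=
  exists w, [/\ analytic_on_disk w,
    forall z, unit_disk z -> unit_disk (w z),
    w 0 = 0 &
    forall z, unit_disk z -> g z = F (w z)].

Definition starlike_quotient f (z : R[i]) : R[i] :=
  if z == 0 then 1 else z * derive1 f z / f z.

Definition class_Sstar phi f : Prop :=
  class_S f /\ subordinate (starlike_quotient f) phi.

(* `|i - j|%N is the distance between the natural numbers i and j. *)
Definition toeplitz_det f q n : R[i] :=
  \det (\matrix_(i < q, j < q) taylor_coef f (n + `|i - j|)%N).

End ComplexDisk.

(* Main.v *)
(* Write z f'/f = phi o w with w(z) = c1 z + c2 z^2 + ... a Schwarz function and
   phi = 1 + B1 z + B2 z^2 + .... Comparing coefficients in f' = (f/z) (phi o w),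
   a2 = B1 c1 and 2 a3 = B1 c2 + (B2 + B1^2) c1^2. Since |c2| <= 1 - |c1|^2 and
   B1 <= |B2 + B1^2|, this gives |a2| <= B1 and 2 |a3| <= |B2 + B1^2|, and the
   bound follows from |a3^2 - a2^2| <= |a3|^2 + |a2|^2. Equality holds for
   w(z) = i z: the function is f = z exp q with q' = (phi(i z) - 1) / z, and it
   is univalent because t + q(exp t) has derivative phi(i exp t), of positive
   real part, on the half-plane Re t < 0.

   Complex differentiability on the disk yields a power series as follows.
   Trapezoid sums replace integrals: Goursat's bisection shows that they tend to
   0 around triangles, so the mean over |z| = r of f(z) z^-k, taken along an
   ultrafilter, does not depend on r, and Chernoff's proof of the convergence of
   Fourier series (a telescoping sum and Bessel's inequality) gives
   f(a) = sum_k c_k a^k. Bessel's inequality for w(z) (1 + y z), optimised in y,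
   also gives |c2| <= 1 - |c1|^2. *)

Require Import Defs.
From HB Require Import structures.
From mathcomp Require Import all_boot all_order all_algebra.
From mathcomp Require Import complex.
From mathcomp Require Import all_classical all_reals all_analysis.
From mathcomp Require Import ring lra.

Set Implicit Arguments.
Unset Strict Implicit.
Unset Printing Implicit Defensive.

Import Order.TTheory GRing.Theory Num.Theory.
Import numFieldNormedType.Exports.
Import ComplexField.Normc.

Local Open Scope ring_scope.
Local Open Scope complex_scope.
Local Open Scope classical_set_scope.

(** * Complex modulus and limits along an ultrafilter *)

Section Modulus.
Variable R : realType.
Implicit Types (x y z : R[i]).

(** The hypotheses give complex differentiability at each point, without continuity of the
    derivative, whereas the coefficients are iterated derivatives at 0; most of the work lies
    between the two. The coordinate z = exp t shapes it: the disk without 0 becomes the half-plane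
    Re t < 0, a circle becomes a vertical segment of length 2 pi, and an annulus becomes a rectangle
    whose horizontal sides agree by periodicity. Goursat's lemma is thus needed only for triangles
    in a convex set. Of the means, only linearity, positivity and bounds are used, and all three
    survive a limit along an ultrafilter.

    With K = B2 + B1^2, the bound on 2 |a3| is a convex combination of B1 and |K| with weights 1 -
    |c1|^2 and |c1|^2, up to the Schwarz estimate. Both coefficient bounds are attained for w(z) =
    c1 z with |c1| = 1; then a2^2 = B1^2 c1^2 and a3^2 = K^2 c1^4 / 4. The triangle inequality for
    a3^2 - a2^2 loses nothing when these squares have opposite directions, that is, when c1^2 = -1:
    this is the origin of the rotation by i. *)

Lemma normr_normc z : `|z| = (normc z)%:C.
Proof. by []. Qed.

Lemma normc_ge0 z : 0 <= normc z.
Proof. by rewrite -lecR -normr_normc; exact: normr_ge0. Qed.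

Lemma ler_normcD x y : normc (x + y) <= normc x + normc y.
Proof. exact: le_normcD. Qed.

Lemma normcN z : normc (- z) = normc z.
Proof. by apply: (@complexI R); rewrite -!normr_normc normrN. Qed.

Lemma normcB x y : normc (x - y) = normc (y - x).
Proof. by rewrite -opprB normcN. Qed.

Lemma ler_normcB x y : normc (x - y) <= normc x + normc y.
Proof. by rewrite -(normcN y) ler_normcD. Qed.

Lemma ler_dist_normcD y x z : normc (x - z) <= normc (x - y) + normc (y - z).
Proof. by rewrite (le_trans _ (ler_normcD _ _)) // addrA subrK. Qed.

Lemma normcX z n : normc (z ^+ n) = normc z ^+ n.
Proof. by elim: n => [|n IH]; rewrite ?normc1 // !exprS normcM IH. Qed.

Lemma normc_eq0 z : (normc z == 0) = (z == 0).
Proof.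
by apply/eqP/eqP => [/eq0_normc //|->]; rewrite normc0.
Qed.

Lemma normc_gt0 z : (0 < normc z) = (z != 0).
Proof. by rewrite lt_neqAle normc_ge0 andbT eq_sym normc_eq0. Qed.

Lemma normc_real (r : R) : normc r%:C = `|r|.
Proof. by rewrite /normc /= expr0n addr0 sqrtr_sqr. Qed.

Lemma normc_nat n : normc (n%:R : R[i]) = n%:R.
Proof.
by rewrite -(rmorph_nat (real_complex R)) normc_real ger0_norm.
Qed.

Lemma normc_conj z : normc (conjc z) = normc z.
Proof. by apply: (@complexI R); rewrite -!normr_normc complex.normcJ. Qed.

Lemma sqr_normcE z : normc z ^+ 2 = complex.Re z ^+ 2 + complex.Im z ^+ 2.
Proof. by case: z => a b; rewrite sqr_sqrtr // addr_ge0 // sqr_ge0. Qed.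

Lemma mulcJ z : z * conjc z = (normc z ^+ 2)%:C.
Proof. by rewrite -sqr_normc normr_normc rmorphXn. Qed.

Lemma Re_le_normc z : complex.Re z <= normc z.
Proof.
case: z => a b /=; rewrite (le_trans (ler_norm _)) // -sqrtr_sqr.
by rewrite ler_wsqrtr // lerDl sqr_ge0.
Qed.

Lemma Im_le_normc z : complex.Im z <= normc z.
Proof.
case: z => a b /=; rewrite (le_trans (ler_norm _)) // -sqrtr_sqr.
by rewrite ler_wsqrtr // lerDr sqr_ge0.
Qed.

Lemma normRe_le_normc z : `|complex.Re z| <= normc z.
Proof.
rewrite ler_norml Re_le_normc andbT lerNl.
by rewrite -(normcN z) (le_trans _ (Re_le_normc _)) //; case: z.
Qed.

Lemma normIm_le_normc z : `|complex.Im z| <= normc z.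
Proof.
rewrite ler_norml Im_le_normc andbT lerNl.
by rewrite -(normcN z) (le_trans _ (Im_le_normc _)) //; case: z.
Qed.

Lemma normc_le_ReIm z : normc z <= `|complex.Re z| + `|complex.Im z|.
Proof.
rewrite -(ler_pXn2r (n := 2)) ?nnegrE ?normc_ge0 ?addr_ge0 //.
rewrite sqr_normcE sqrrD !real_normK ?num_real //.
by rewrite lerD2r lerDl mulrn_wge0 // mulr_ge0.
Qed.

Lemma unit_diskE z : unit_disk z <-> normc z < 1.
Proof. by rewrite /unit_disk /= normr_normc -(rmorph1 (real_complex R)) ltcR. Qed.

Lemma cReD x y : complex.Re (x + y) = complex.Re x + complex.Re y.
Proof. by case: x; case: y. Qed.

Lemma cImD x y : complex.Im (x + y) = complex.Im x + complex.Im y.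
Proof. by case: x; case: y. Qed.

Lemma cReM x y : complex.Re (x * y) =
  complex.Re x * complex.Re y - complex.Im x * complex.Im y.
Proof. by case: x; case: y. Qed.

Lemma cImM x y : complex.Im (x * y) =
  complex.Re x * complex.Im y + complex.Im x * complex.Re y.
Proof. by case: x; case: y. Qed.

End Modulus.

Section GeneralizedLimit.

Definition free_ultrafilter : set_system nat :=
  projT1 (cid (ultraFilterLemma (F := \oo) _)).

#[local] Instance free_ultrafilter_ultra : UltraFilter free_ultrafilter.
Proof. by rewrite /free_ultrafilter; case: cid => ? []. Qed.

Lemma sub_free_ultrafilter : \oo `<=` free_ultrafilter.
Proof. by rewrite /free_ultrafilter; case: cid => ? []. Qed.

Lemma free_ultrafilterW (P : nat -> Prop) N :
  (forall n, (N <= n)%N -> P n) -> free_ultrafilter P.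
Proof. by move=> NP; apply: (@sub_free_ultrafilter P); exists N. Qed.

Variable R : realType.

(** A bound is asked only from some rank on, because a bound deduced from convergence, as in
    [cvg_ulim], holds no earlier. *)
Definition ev_bounded (u : nat -> R[i]) : Prop :=
  exists (M : R) N, forall n, (N <= n)%N -> normc (u n) <= M.

Definition rlim (u : nat -> R) : R := lim (u @ free_ultrafilter).

(* Limits along a free ultrafilter exist for all bounded sequences, so that the
   convergence of the trapezoid sums below need not be proved. *)
Definition ulim (u : nat -> R[i]) : R[i] :=
  rlim (fun n => complex.Re (u n)) +i* rlim (fun n => complex.Im (u n)).

(** Compactness of [-M, M] provides a cluster point, and an ultrafilter converges to each of its
    cluster points: it contains a set or its complement. *)
Lemma cvg_rlim (u : nat -> R) (M : R) N : (forall n, (N <= n)%N -> `|u n| <= M) ->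
  u @ free_ultrafilter --> rlim u.
Proof.
move=> uM.
have Uu : (u @ free_ultrafilter) `[- M, M].
  apply: (@free_ultrafilterW (u @^-1` `[- M, M]) N) => n /uM /=.
  by rewrite ler_norml in_itv.
have [l [_ ul]] := @segment_compact R _ _ _ _ Uu.
apply/cvg_ex; exists l => B lB.
have [//|nB] := in_ultra_setVsetC (u @^-1` B) free_ultrafilter_ultra.
by have [x []] := ul (~` B) B nB lB.
Qed.

Lemma rlim_le (u : nat -> R) (M M' : R) N : (forall n, (N <= n)%N -> `|u n| <= M') ->
  (forall n, (N <= n)%N -> u n <= M) -> rlim u <= M.
Proof.
move=> /cvg_rlim cu uM; apply: (closed_cvg (fun x => x <= M)) cu.
  exact: closed_le.
exact: (@free_ultrafilterW (fun n => u n <= M) N).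
Qed.

Lemma ev_boundedE u : ev_bounded u ->
  (exists (M : R) N, forall n, (N <= n)%N -> `|complex.Re (u n)| <= M) /\
  (exists (M : R) N, forall n, (N <= n)%N -> `|complex.Im (u n)| <= M).
Proof.
move=> [M [N uM]]; split; exists M, N => n /uM; apply: le_trans.
  exact: normRe_le_normc.
exact: normIm_le_normc.
Qed.

Lemma ev_bounded_cvg u : ev_bounded u ->
  (fun n => complex.Re (u n)) @ free_ultrafilter --> complex.Re (ulim u) /\
  (fun n => complex.Im (u n)) @ free_ultrafilter --> complex.Im (ulim u).
Proof.
move=> /ev_boundedE [[M [N uM]] [M' [N' uM']]].
by split; [exact: cvg_rlim uM|exact: cvg_rlim uM'].
Qed.

Lemma ulim_unique u l :
  (fun n => complex.Re (u n)) @ free_ultrafilter --> complex.Re l ->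
  (fun n => complex.Im (u n)) @ free_ultrafilter --> complex.Im l ->
  ulim u = l.
Proof.
by case: l => a b /cvg_lim + /cvg_lim; rewrite /ulim /rlim /= => -> // ->.
Qed.

Lemma ev_boundedD u v : ev_bounded u -> ev_bounded v ->
  ev_bounded (fun n => u n + v n).
Proof.
move=> [M [N uM]] [M' [N' vM]]; exists (M + M'), (maxn N N') => n.
rewrite geq_max => /andP[/uM ? /vM ?].
by rewrite (le_trans (ler_normcD _ _)) // lerD.
Qed.

Lemma ev_boundedZ c u : ev_bounded u -> ev_bounded (fun n => c * u n).
Proof.
move=> [M [N uM]]; exists (normc c * M), N => n /uM ?.
by rewrite normcM ler_wpM2l // normc_ge0.
Qed.

Lemma ev_bounded_cst c : ev_bounded (fun=> c).
Proof. by exists (normc c), 0%N. Qed.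

Lemma ulimD u v : ev_bounded u -> ev_bounded v ->
  ulim (fun n => u n + v n) = ulim u + ulim v.
Proof.
move=> /ev_bounded_cvg[u1 u2] /ev_bounded_cvg[v1 v2]; apply: ulim_unique.
  by rewrite cReD; under eq_fun do rewrite cReD; exact: cvgD.
by rewrite cImD; under eq_fun do rewrite cImD; exact: cvgD.
Qed.

Lemma ulimZ c u : ev_bounded u -> ulim (fun n => c * u n) = c * ulim u.
Proof.
move=> /ev_bounded_cvg[u1 u2]; apply: ulim_unique.
  rewrite cReM; under eq_fun do rewrite cReM.
  by apply: cvgB; apply: cvgM => //; exact: cvg_cst.
rewrite cImM; under eq_fun do rewrite cImM.
by apply: cvgD; apply: cvgM => //; exact: cvg_cst.
Qed.

Lemma ulim_cst c : ulim (fun=> c) = c.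
Proof. by apply: ulim_unique; exact: cvg_cst. Qed.

Lemma ulimB u v : ev_bounded u -> ev_bounded v ->
  ulim (fun n => u n - v n) = ulim u - ulim v.
Proof.
move=> bu bv; rewrite -mulN1r -ulimZ // -ulimD //; last exact: ev_boundedZ.
by congr ulim; apply/funext => n; rewrite mulN1r.
Qed.

Lemma ulim_conj u : ev_bounded u -> ulim (fun n => conjc (u n)) = conjc (ulim u).
Proof.
move=> /ev_bounded_cvg[u1 u2]; apply: ulim_unique.
  have -> : (fun n => complex.Re (conjc (u n))) = (fun n => complex.Re (u n)).
    by apply/funext => n; case: (u n).
  by case: (ulim u) u1.
have -> : (fun n => complex.Im (conjc (u n))) = (fun n => - complex.Im (u n)).
  by apply/funext => n; case: (u n).
by case: (ulim u) u2 => a b /= u2; exact: cvgN.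
Qed.

Lemma Re_ulim_le u (M : R) : ev_bounded u ->
  (exists N, forall n, (N <= n)%N -> complex.Re (u n) <= M) ->
  complex.Re (ulim u) <= M.
Proof.
move=> /ev_boundedE[[M' [N' uM']] _] [N uM].
apply: (@rlim_le _ _ M' (maxn N N')) => n; rewrite geq_max => /andP[? ?].
  exact: uM'.
exact: uM.
Qed.

(** With l the limit, |l|^2 is the limit of Re (conj l * u n), which is at most |l| M. This reduces
    the modulus to the real-part bound [Re_ulim_le]. *)
Lemma ulim_le u (M : R) :
  (exists N, forall n, (N <= n)%N -> normc (u n) <= M) -> normc (ulim u) <= M.
Proof.
move=> [N uM]; have M0 : 0 <= M by rewrite (le_trans _ (uM N _)) ?normc_ge0.
have bu : ev_bounded u by exists M, N.
have [->|l0] := eqVneq (ulim u) 0; first by rewrite normc0.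
have : complex.Re (conjc (ulim u) * ulim u) <= normc (ulim u) * M.
  rewrite -ulimZ //; apply: Re_ulim_le; first exact: ev_boundedZ.
  exists N => n /uM ?; rewrite (le_trans (Re_le_normc _)) // normcM normc_conj.
  by rewrite ler_wpM2l // normc_ge0.
have -> : complex.Re (conjc (ulim u) * ulim u) = normc (ulim u) * normc (ulim u).
  by rewrite mulrC mulcJ -expr2.
by rewrite ler_pM2l ?normc_gt0.
Qed.

Lemma cvg_ulim u l : (forall e : R, 0 < e ->
    exists N, forall n, (N <= n)%N -> normc (u n - l) <= e) ->
  ulim u = l.
Proof.
move=> ul; have bu : ev_bounded u.
  have [N uN] := ul 1 ltr01; exists (1 + normc l), N => n /uN ?.
  by rewrite -(subrK l (u n)) (le_trans (ler_normcD _ _)) // lerD2r.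
apply/eqP; rewrite -subr_eq0 -normc_eq0 eq_le normc_ge0 andbT.
apply/ler_addgt0Pr => e e0; rewrite add0r.
rewrite -(ulim_cst l) -ulimB //; last exact: ev_bounded_cst.
exact/ulim_le/ul.
Qed.

Lemma eq_ulim u v : (forall n, u n = v n) -> ulim u = ulim v.
Proof. by move=> uv; congr ulim; apply/funext. Qed.

Lemma ulim_ge0 u : ev_bounded u -> (forall n, 0 <= u n) -> 0 <= ulim u.
Proof.
move=> bu u0; rewrite lecE; apply/andP; split; last first.
  have := @Re_ulim_le (fun n => -1 * u n) 0 (ev_boundedZ _ bu).
  rewrite ulimZ // cReM /= => h.
  have : -1 * complex.Re (ulim u) - 0 * complex.Im (ulim u) <= 0.
    rewrite -[X in X * complex.Im _]oppr0; apply: h; exists 0%N => n _.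
    move: (u0 n); rewrite lecE cReM /= => /andP[_]; lra.
  by move=> /=; lra.
apply/eqP; rewrite /ulim /=.
rewrite (_ : (fun n => complex.Im (u n)) = cst 0); first by apply: cvg_lim => //; exact: cvg_cst.
by apply/funext => n /=; exact: ger0_Im.
Qed.

End GeneralizedLimit.

(** * Complex derivative and exponential *)

Section ComplexDerivative.
Variable R : realType.
Implicit Types (f g : R[i] -> R[i]) (z l m h : R[i]).

Lemma ltr0c (r : R) : (0 < r%:C) = (0 < r).
Proof. by rewrite ltcE /= eqxx. Qed.

(** Multiplying the difference quotient out by |h| admits h = 0, which the chain rule needs, and the
    tolerances are real numbers instead of elements of R[i]. *)
Definition cderiv f z l : Prop := forall e : R, 0 < e ->
  exists2 d : R, 0 < d & forall h, normc h < d ->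
    normc (f (z + h) - f z - l * h) <= e * normc h.

Lemma cderivP f z l :
  cderiv f z l <-> derivable f z 1 /\ derive1 f z = l.
Proof.
have E : (fun h : R[i] => h^-1 *: (f (h%:A + z) - f z)) =
         (fun h : R[i] => h^-1 *: (f (h + z) - f z)).
  by apply/funext => h; rewrite [h%:A]mulr1.
suff H : cderiv f z l <->
    (fun h : R[i] => h^-1 *: (f (h + z) - f z)) @ 0^' --> l.
  rewrite H /derivable E; split=> [H1|[H1 <-]//].
  by split; [apply/cvg_ex; exists l | exact: cvg_lim].
split=> [fl|/cvgrPdist_le fl e e0].
  (* A positive element of R[i] is real, so the tolerance has imaginary part 0. *)
  apply/cvgrPdist_le => -[a b]; rewrite ltcE /= => /andP[/eqP -> a0].
  have [d d0 fd] := fl a a0.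
  exists d%:C; first by rewrite /= ltr0c.
  move=> h; rewrite /= sub0r normrN normr_normc. 
 rewrite ltcR => hd h0.
  rewrite -[_ *: _]/(_ * _) (_ : l - _ = - (h^-1 * (f (z + h) - f z - l * h))).
    by rewrite normr_normc normcN normcM normcV -[_ +i* 0]/(a%:C) lecR mulrC
      ler_pdivrMr ?normc_gt0 // fd.
  by rewrite [h + z]addrC; field.
have := fl e%:C; rewrite ltr0c => /(_ e0) [[d d'] /=].
rewrite ltcE /= => /andP[/eqP -> d0] H; exists d => // h hd.
have [->|h0] := eqVneq h 0; first by rewrite addr0 mulr0 subrr subr0 normc0 mulr0.
have := H h; rewrite /= sub0r normrN normr_normc ltcR => /(_ hd h0).
rewrite -[_ *: _]/(_ * _) (_ : l - _ = - (h^-1 * (f (z + h) - f z - l * h))).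
  by rewrite normr_normc normcN normcM normcV lecR mulrC ler_pdivrMr ?normc_gt0.
by rewrite [h + z]addrC; field.
Qed.

Lemma cderiv_is_derive f z l : cderiv f z l <-> is_derive z 1 f l.
Proof.
rewrite cderivP derive1E; split=> [[? <-]|[? <-]] //; exact: DeriveDef.
Qed.

Lemma derive1_cderiv f z l : cderiv f z l -> derive1 f z = l.
Proof. by move=> /cderivP[]. Qed.

Lemma cderiv_derive1 f z : derivable f z 1 -> cderiv f z (derive1 f z).
Proof. by move=> ?; apply/cderivP. Qed.

Lemma cderiv_ext f g z l (d : R) : 0 < d ->
  (forall h, normc h < d -> f (z + h) = g (z + h)) ->
  cderiv f z l -> cderiv g z l.
Proof.
move=> d0 fg fl e e0; have [d' d'0 H] := fl e e0.
exists (Num.min d d'); first by rewrite lt_min d0.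
move=> h; rewrite lt_min => /andP[hd hd'].
rewrite -fg // -[X in g X]addr0 -fg ?normc0 // addr0; exact: H.
Qed.

Lemma cderiv_unique f z l m : cderiv f z l -> cderiv f z m -> l = m.
Proof. by move=> /derive1_cderiv <- /derive1_cderiv <-. Qed.

Lemma cderiv_cst c z : cderiv (fun=> c) z 0.
Proof. by apply/cderiv_is_derive; exact: is_derive_cst. Qed.

Lemma cderiv_id z : cderiv (fun w => w) z 1.
Proof. by apply/cderiv_is_derive; exact: is_derive_id. Qed.

Lemma cderivD f g z l m : cderiv f z l -> cderiv g z m ->
  cderiv (fun w => f w + g w) z (l + m).
Proof.
by move=> /cderiv_is_derive ? /cderiv_is_derive ?; apply/cderiv_is_derive;
  exact: is_deriveD.
Qed.

Lemma cderivM f g z l m : cderiv f z l -> cderiv g z m ->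
  cderiv (fun w => f w * g w) z (f z * m + g z * l).
Proof.
by move=> /cderiv_is_derive ? /cderiv_is_derive ?; apply/cderiv_is_derive;
  exact: is_deriveM.
Qed.

Lemma cderivZ c f z l : cderiv f z l -> cderiv (fun w => c * f w) z (c * l).
Proof. by move=> fl; have := cderivM (cderiv_cst c z) fl; rewrite mulr0 addr0. Qed.

(** The increment k of g satisfies |k| <= (|m| + 1) |h|, and the error of g is multiplied by l;
    hence the two tolerances, each of which costs half of e. *)
Lemma cderiv_comp f g z l m : cderiv f (g z) l -> cderiv g z m ->
  cderiv (fun w => f (g w)) z (l * m).
Proof.
move=> fl gm e e0.
have m1 : 0 < normc m + 1 by rewrite ltr_wpDl ?normc_ge0.
have l1 : 0 < normc l + 1 by rewrite ltr_wpDl ?normc_ge0.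
have [d1 d10 H1] := fl (e / 2 / (normc m + 1)) (divr_gt0 (divr_gt0 e0 (ltr0Sn R 1)) m1).
have [d2 d20 H2] := gm 1 ltr01.
have [d3 d30 H3] := gm (e / 2 / (normc l + 1)) (divr_gt0 (divr_gt0 e0 (ltr0Sn R 1)) l1).
exists (Num.min (d1 / (normc m + 1)) (Num.min d2 d3)).
  by rewrite !lt_min d20 d30 divr_gt0.
move=> h; rewrite !lt_min => /and3P[hd1 hd2 hd3].
have {H2}H2 := H2 h hd2; have {H3}H3 := H3 h hd3.
set k := g (z + h) - g z in H2 H3 *.
have kh : normc k <= (normc m + 1) * normc h.
  rewrite -(subrK (m * h) k) (le_trans (ler_normcD _ _)) // normcM mulrDl addrC.
  by rewrite lerD2l.
have /H1 : normc k < d1.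
  by rewrite (le_lt_trans kh) // mulrC -ltr_pdivlMr.
rewrite (_ : g z + k = g (z + h)); last by rewrite /k addrC subrK.
move=> {}H1.
rewrite (_ : f (g (z + h)) - f (g z) - l * m * h =
  (f (g (z + h)) - f (g z) - l * k) + l * (k - m * h)); last by ring.
rewrite (le_trans (ler_normcD _ _)) // [e]splitr mulrDl lerD //.
  rewrite (le_trans H1) // (le_trans (ler_wpM2l _ kh)) //.
    by rewrite !divr_ge0 // ltW.
  by rewrite mulrA divfK ?gt_eqF.
rewrite normcM (le_trans (ler_wpM2l _ H3)) ?normc_ge0 //.
rewrite mulrA ler_wpM2r ?normc_ge0 // mulrA ler_pdivrMr //.
by rewrite mulrC ler_pM2l ?divr_gt0 // lerDl.
Qed.

Lemma cderiv_lipschitz f z l : cderiv f z l ->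
  exists2 d : R, 0 < d & forall h, normc h < d ->
    normc (f (z + h) - f z) <= (normc l + 1) * normc h.
Proof.
move=> /(_ 1 ltr01)[d d0 H]; exists d => // h hd.
rewrite -(subrK (l * h) (f (z + h) - f z)) (le_trans (ler_normcD _ _)) //.
by rewrite normcM mulrDl addrC lerD2l H.
Qed.

End ComplexDerivative.

(** * The complex exponential: addition law, kernel and range *)

Section ComplexExponential.
Variable R : realType.
Implicit Types (z w : R[i]) (x y t : R).

Definition cexp z : R[i] :=
  (expR (complex.Re z) * cos (complex.Im z)) +i*
  (expR (complex.Re z) * sin (complex.Im z)).

Lemma cexpD z w : cexp (z + w) = cexp z * cexp w.
Proof.
case: z w => a b [c d]; apply/eqP; rewrite eq_complex /= expRD cosD sinD.
by apply/andP; split; apply/eqP; ring.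
Qed.

Lemma cexp0 : cexp 0 = 1.
Proof.
by apply/eqP; rewrite eq_complex /= expR0 cos0 sin0 !mul1r !eqxx.
Qed.

Lemma normc_cexp z : normc (cexp z) = expR (complex.Re z).
Proof.
rewrite /normc /= !exprMn -mulrDr cos2Dsin2 mulr1 sqrtr_sqr.
by rewrite ger0_norm // expR_ge0.
Qed.

Lemma cexp_neq0 z : cexp z != 0.
Proof. by rewrite -normc_gt0 normc_cexp expR_gt0. Qed.

Lemma cexpN z : cexp (- z) = (cexp z)^-1.
Proof.
by apply: (mulfI (cexp_neq0 z)); rewrite -cexpD subrr cexp0 divff ?cexp_neq0.
Qed.

Lemma cexpMn z n : cexp (n%:R * z) = cexp z ^+ n.
Proof.
elim: n => [|n IH]; first by rewrite mul0r cexp0 expr0.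
by rewrite -addn1 natrD mulrDl mul1r cexpD IH exprD.
Qed.

Definition i2pi : R[i] := 0 +i* (pi *+ 2).

Lemma cexp_i2pi : cexp i2pi = 1.
Proof.
by apply/eqP; rewrite eq_complex /= expR0 cos2pi sin2pi !mul1r !eqxx.
Qed.

(** The modulus forces Re z = 0. Reducing Im z modulo 2 pi gives t in [0, 2 pi) with cos t = 1;
    cosine is injective on [0, pi], and t > pi is reflected to 2 pi - t. *)
Lemma cexp_eq1 z : cexp z = 1 -> exists k : int, z = k%:~R * i2pi.
Proof.
case: z => x y /eqP; rewrite eq_complex /= => /andP[/eqP ec /eqP es].
have x0 : x = 0.
  have := normc_cexp (x +i* y); rewrite /normc /= ec es expr0n addr0 expr1n sqrtr1.
  by move=> /esym; rewrite -expR0 => /expR_inj.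
move: ec es; rewrite {}x0 expR0 !mul1r => ec es.
have pi2 : 0 < pi *+ 2 :> R by rewrite mulrn_wgt0 // pi_gt0.
pose k := Num.floor (y / (pi *+ 2)); exists k.
pose t := y - k%:~R * (pi *+ 2).
have cosM (m : int) (s : R) : cos (s + m%:~R * (pi *+ 2)) = cos s.
  have cosMn (n : nat) (r : R) : cos (r + n%:R * (pi *+ 2)) = cos r.
    by rewrite mulr_natl; apply: (periodicn (@cosD2pi R)).
  case: m => n; first exact: cosMn.
  by rewrite NegzE mulrNz mulNr -[LHS](cosMn n.+1) subrK.
have ct : cos t = 1 by rewrite -ec -(cosM k t) subrK.
have t0 : 0 <= t by rewrite subr_ge0 -ler_pdivlMr // floor_le.
have t2 : t < pi *+ 2.
  rewrite /t ltrBlDl -{2}[pi *+ 2]mul1r -mulrDl -ltr_pdivrMr //.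
  by have := floorD1_gt (y / (pi *+ 2)); rewrite intrD.
suff t00 : t = 0.
  apply/eqP; rewrite -(rmorph_int (real_complex R)) eq_complex /=.
  by rewrite !mulr0 !mul0r subrr addr0 eqxx -subr_eq0 -[X in X == 0]/t t00 eqxx.
have [tpi|tpi] := leP t pi.
  by apply: cos_inj; rewrite ?in_itv /= ?t0 ?tpi ?lexx ?pi_ge0 // ct cos0.
have : pi *+ 2 - t = 0.
  apply: cos_inj; rewrite ?in_itv /= ?lexx ?pi_ge0 //.
    by rewrite subr_ge0 ltW //= mulr2n lerBlDr lerD2l ltW.
  by rewrite cos0 -ct -(cosM (-1) (pi *+ 2 - t)) mulN1r addrAC subrr sub0r cosN.
by move/eqP; rewrite subr_eq0 => /eqP E; move: t2; rewrite E ltxx.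
Qed.

(** Polar coordinates: [acos] of Re z / |z| gives the angle up to sign, and the sign of Im z
    decides. *)
Lemma cexp_onto z : z != 0 -> exists w, z = cexp w.
Proof.
rewrite -normc_gt0 => z0; set r := normc z in z0.
have rr : complex.Re z ^+ 2 + complex.Im z ^+ 2 = r ^+ 2 by rewrite sqr_normcE.
pose a := complex.Re z / r; pose b := complex.Im z / r.
have ab : a ^+ 2 + b ^+ 2 = 1.
  by rewrite !expr_div_n -mulrDl rr divff // expf_neq0 // gt_eqF.
have a1 : -1 <= a <= 1.
  rewrite -ler_norml -(ler_pXn2r (n := 2)) ?nnegrE // real_normK ?num_real //.
  by rewrite expr1n -ab lerDl sqr_ge0.
have sa : sin (acos a) = `|b|.
  by rewrite sin_acos // -ab addrAC subrr add0r sqrtr_sqr.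
have ca : cos (acos a) = a by rewrite acosK ?in_itv.
exists (ln r +i* (if 0 <= b then acos a else - acos a)).
apply/eqP; rewrite eq_complex /= lnK ?posrE //.
have -> : cos (if 0 <= b then acos a else - acos a) = a.
  by case: ifP => _; rewrite ?cosN.
have -> : sin (if 0 <= b then acos a else - acos a) = b.
  case: ifPn => [b0|]; first by rewrite sa ger0_norm.
  by rewrite -ltNge => b0; rewrite sinN sa ltr0_norm // opprK.
by rewrite /a /b ![r * _]mulrC !divfK ?(lt0r_neq0 z0) ?eqxx.
Qed.

End ComplexExponential.

Section RealDerivative.
Variable R : realType.
Implicit Types (f : R -> R) (x l h e d : R).

Lemma is_derive_epsdelta f x l : is_derive x 1 f l <->
  forall e, 0 < e -> exists2 d : R, 0 < d &
    forall h, `|h| < d -> `|f (x + h) - f x - l * h| <= e * `|h|.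
Proof.
have E : (fun h => h^-1 *: (f (h%:A + x) - f x)) =
         (fun h => h^-1 *: (f (h + x) - f x)).
  by apply/funext => h; rewrite [h%:A]mulr1.
suff H : (fun h => h^-1 *: (f (h + x) - f x)) @ 0^' --> l <->
  forall e, 0 < e -> exists2 d : R, 0 < d &
    forall h, `|h| < d -> `|f (x + h) - f x - l * h| <= e * `|h|.
  rewrite -H; split=> [[]|fl].
    by rewrite -derive1E /derivable E => /[swap] <-.
  apply: DeriveDef; first by rewrite /derivable E; apply/cvg_ex; exists l.
  by rewrite -derive1E; exact: cvg_lim.
have E2 h : h != 0 -> `|l - h^-1 *: (f (h + x) - f x)| =
    `|f (x + h) - f x - l * h| / `|h|.
  move=> h0; rewrite -[_ *: _]/(_ * _) -normfV -normrM -normrN; congr `|_|.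
  by rewrite [h + x]addrC; field.
split=> [/cvgrPdist_le fl e e0|fl].
  have [d /= d0 H] := fl e e0; exists d => // h hd.
  have [->|h0] := eqVneq h 0.
    by rewrite addr0 mulr0 subrr subr0 !normr0 mulr0.
  have := H h; rewrite /= sub0r normrN => /(_ hd h0).
  by rewrite E2 // ler_pdivrMr // normr_gt0.
apply/cvgrPdist_le => e e0; have [d d0 fd] := fl e e0.
exists d => // h; rewrite /= sub0r normrN => hd h0.
by rewrite E2 // ler_pdivrMr ?normr_gt0 // fd.
Qed.

End RealDerivative.

Section ComplexExponentialDerivative.
Variable R : realType.
Implicit Types (z h : R[i]) (e d : R).

Lemma cderiv_cexp0 : cderiv (@cexp R) 0 1.
Proof.
move=> e0 e00.
(* The error is at most 4 e |h| in the real part and 5 e |h| in the imaginary part, whence the 9; e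
   <= 1 serves to bound exp x by 3 and exp x - 1 by 2 |h|. *)
have [e [e_gt0 e1 e9]] : exists e : R, [/\ 0 < e, e <= 1 & 9 * e <= e0].
  exists (Num.min (e0 / 9) 1); split; last 1 first.
  - by rewrite mulrC -ler_pdivlMr // ge_min lexx.
  - by rewrite lt_min ltr01 divr_gt0 // ltr0n.
  - by rewrite ge_min lexx orbT.
have [d1 d10 H1] := (is_derive_epsdelta _ _ _).1 (is_derive_expR (0 : R)) e e_gt0.
have [d2 d20 H2] := (is_derive_epsdelta _ _ _).1 (is_derive_cos (0 : R)) e e_gt0.
have [d3 d30 H3] := (is_derive_epsdelta _ _ _).1 (is_derive_sin (0 : R)) e e_gt0.
exists (Num.min (Num.min d1 d2) (Num.min d3 e)).
  by rewrite !lt_min d10 d20 d30 e_gt0.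
move=> h; rewrite !lt_min add0r mul1r cexp0 => /andP[/andP[hd1 hd2] /andP[hd3 he]].
move: (normRe_le_normc h) (normIm_le_normc h).
set s := normc h in hd1 hd2 hd3 he *.
set x := complex.Re h; set y := complex.Im h => xs ys.
have {H1} := H1 x (le_lt_trans xs hd1).
have {H2} := H2 y (le_lt_trans ys hd2).
have {H3} := H3 y (le_lt_trans ys hd3).
rewrite !add0r expR0 cos0 sin0 oppr0 mul0r !subr0 addr0 !mul1r => B3 B2 B1.
have s0 : 0 <= s by exact: normc_ge0.
have X1 : `|expR x - 1| <= 2 * s.
  rewrite -(subrK x (expR x - 1)) (le_trans (ler_normD _ _)) //.
  have := ler_wpM2r (normr_ge0 x) e1; lra.
have X3 : `|expR x| <= 3.
  rewrite -(subrK 1 (expR x)) (le_trans (ler_normD _ _)) // normr1.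
  have := lt_le_trans he e1; lra.
apply: (le_trans (normc_le_ReIm _)).
have -> : complex.Re (cexp h - 1 - h) = expR x * cos y - 1 - x.
  by rewrite /x /y; case: (h).
have -> : complex.Im (cexp h - 1 - h) = expR x * sin y - 0 - y.
  by rewrite /x /y; case: (h).
have Y1 : `|expR x * cos y - 1 - x| <= 4 * e * s.
  rewrite (_ : _ - x = (expR x - 1 - x) + expR x * (cos y - 1)); last by ring.
  rewrite (le_trans (ler_normD _ _)) // normrM.
  have := ler_pM (normr_ge0 _) (normr_ge0 _) X3 B2.
  have := ler_wpM2l (ltW e_gt0) xs; have := ler_wpM2l (ltW e_gt0) ys.
  lra.
have Y2 : `|expR x * sin y - 0 - y| <= 5 * e * s.
  rewrite subr0 (_ : _ - y = expR x * (sin y - y) + (expR x - 1) * y); last by ring.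
  rewrite (le_trans (ler_normD _ _)) // !normrM.
  have := ler_pM (normr_ge0 _) (normr_ge0 _) X3 B3.
  have := ler_pM (normr_ge0 _) (normr_ge0 _) X1 ys.
  have := ler_wpM2l (ltW e_gt0) ys.
  have := ler_wpM2r s0 (ltW he).
  lra.
have := ler_wpM2r s0 e9; lra.
Qed.

Lemma cderiv_cexp z : cderiv (@cexp R) z (cexp z).
Proof.
move=> e e0; have c0 : 0 < normc (cexp z) by rewrite normc_gt0 cexp_neq0.
have [d d0 H] := cderiv_cexp0 (divr_gt0 e0 c0); exists d => // h /H.
rewrite add0r cexp0 mul1r => {}H.
have -> : cexp (z + h) - cexp z - cexp z * h = cexp z * (cexp h - 1 - h).
  by rewrite cexpD; ring.
rewrite normcM (le_trans (ler_wpM2l _ H)) ?normc_ge0 //.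
by rewrite mulrA [normc _ * _]mulrC divfK ?gt_eqF.
Qed.

Lemma cderiv_cexpZ (c z : R[i]) : cderiv (fun w => cexp (c * w)) z (c * cexp (c * z)).
Proof.
rewrite mulrC; apply: (@cderiv_comp _ (@cexp R) (fun w => c * w)).
  exact: cderiv_cexp.
by have := cderivZ c (cderiv_id z); rewrite mulr1.
Qed.

End ComplexExponentialDerivative.

(** * Goursat's lemma for trapezoid sums *)

Section DyadicMean.
Variable R : realType.
Implicit Types (f g : R[i] -> R[i]) (A B C D z : R[i]) (K : R[i] -> Prop).

(* The trapezoid rule with 2^n steps for the average of g over [A, B]. *)
Fixpoint dmean g n A B : R[i] :=
  if n is m.+1 then (dmean g m A ((A + B) / 2) + dmean g m ((A + B) / 2) B) / 2
  else (g A + g B) / 2.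

(** Closure under midpoints suffices, since [dmean] evaluates only at dyadic points of [A, B]. *)
Definition midconvex K := forall A B, K A -> K B -> K ((A + B) / 2).

Lemma normc_half z : normc (z / 2) = normc z / 2.
Proof. by rewrite normcM normcV normc_nat. Qed.

Lemma ball_midconvex z (r : R) : midconvex (fun w => normc (w - z) <= r).
Proof.
move=> A B Ar Br; rewrite (_ : _ - z = (A - z) / 2 + (B - z) / 2); last by field.
rewrite (le_trans (ler_normcD _ _)) // !normc_half; lra.
Qed.

Lemma Re_half z : complex.Re (z / 2) = complex.Re z / 2.
Proof.
rewrite cReM (_ : 2^-1 = (2^-1)%:C :> R[i]) ?mulr0 ?subr0 //.
by rewrite fmorphV rmorph_nat.
Qed.

Lemma halfplane_midconvex (b : R) : midconvex (fun w => complex.Re w <= b).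
Proof. by move=> A B Ab Bb; rewrite Re_half cReD; lra. Qed.

Lemma line_midconvex (s : R) : midconvex (fun w => complex.Re w = s).
Proof. by move=> A B As Bs; rewrite Re_half cReD; lra. Qed.

Lemma dmeanD f g n A B :
  dmean (fun z => f z + g z) n A B = dmean f n A B + dmean g n A B.
Proof. by elim: n A B => [|n IH] A B /=; rewrite ?IH; field. Qed.

Lemma dmeanZ c g n A B : dmean (fun z => c * g z) n A B = c * dmean g n A B.
Proof. by elim: n A B => [|n IH] A B /=; rewrite ?IH; field. Qed.

Lemma dmean_affine a b n A B :
  dmean (fun z => a + b * z) n A B = a + b * ((A + B) / 2).
Proof. by elim: n A B => [|n IH] A B /=; rewrite ?IH; field. Qed.

Lemma dmean_sym g n A B : dmean g n A B = dmean g n B A.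
Proof.
elim: n A B => [|n IH] A B /=; first by rewrite addrC.
by rewrite [B + A]addrC (IH B) (IH _ A); congr (_ / 2); exact: addrC.
Qed.

Lemma dmean_shift g n A B v :
  dmean g n (A + v) (B + v) = dmean (fun z => g (z + v)) n A B.
Proof.
elim: n A B => [|n IH] A B //=; rewrite -!IH.
by have -> : (A + v + (B + v)) / 2 = (A + B) / 2 + v by field.
Qed.

Lemma eq_dmean K f g n A B : midconvex K -> K A -> K B ->
  (forall z, K z -> f z = g z) -> dmean f n A B = dmean g n A B.
Proof.
move=> Kc KA KB fg; elim: n A B KA KB => [|n IH] A B KA KB /=; first by rewrite !fg.
by have KM := Kc _ _ KA KB; rewrite !IH.
Qed.

Lemma normc_dmean_le K g n A B (M : R) : midconvex K -> K A -> K B ->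
  (forall z, K z -> normc (g z) <= M) -> normc (dmean g n A B) <= M.
Proof.
move=> Kc KA KB gM; elim: n A B KA KB => [|n IH] A B KA KB /=; rewrite normc_half.
  by rewrite ler_pdivrMr // (le_trans (ler_normcD _ _)) // mulr_natr mulr2n lerD ?gM.
have KM := Kc _ _ KA KB.
by rewrite ler_pdivrMr // (le_trans (ler_normcD _ _)) // mulr_natr mulr2n lerD ?IH.
Qed.

Lemma dmean_ge0 K g n A B : midconvex K -> K A -> K B ->
  (forall z, K z -> 0 <= g z) -> 0 <= dmean g n A B.
Proof.
move=> Kc KA KB g0; elim: n A B KA KB => [|n IH] A B KA KB /=.
  by rewrite divr_ge0 ?addr_ge0 ?g0 ?ler0n.
by have KM := Kc _ _ KA KB; rewrite divr_ge0 ?addr_ge0 ?IH ?ler0n.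
Qed.

Lemma dmean_conj g n A B : dmean (fun z => conjc (g z)) n A B = conjc (dmean g n A B).
Proof.
by elim: n A B => [|n IH] A B /=; rewrite ?IH rmorphM rmorphD fmorphV rmorph_nat.
Qed.

(** The trapezoid sum for the integral of g along [A, B]; [tri] is the one around a triangle. *)
Definition edge g n A B := (B - A) * dmean g n A B.

Lemma edgeS g n A B :
  edge g n.+1 A B = edge g n A ((A + B) / 2) + edge g n ((A + B) / 2) B.
Proof. by rewrite /edge /=; field. Qed.

Lemma edgeC g n A B : edge g n B A = - edge g n A B.
Proof. by rewrite /edge dmean_sym; ring. Qed.

Definition tri g n A B C := edge g n A B + edge g n B C + edge g n C A.

(** Goursat's subdivision is an exact identity between trapezoid sums: level n + 1 on a triangle is
    level n on its four quarters, and each inner edge is run through in both directions. *)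
Lemma triS g n A B C : tri g n.+1 A B C =
  tri g n A ((A + B) / 2) ((C + A) / 2) +
  tri g n ((A + B) / 2) B ((B + C) / 2) +
  tri g n ((C + A) / 2) ((B + C) / 2) C +
  tri g n ((A + B) / 2) ((B + C) / 2) ((C + A) / 2).
Proof.
rewrite /tri !edgeS.
rewrite (edgeC g n ((C + A) / 2) ((A + B) / 2)).
rewrite (edgeC g n ((A + B) / 2) ((B + C) / 2)).
by rewrite (edgeC g n ((C + A) / 2) ((B + C) / 2)); ring.
Qed.

(** The trapezoid rule is exact on affine functions, so the three edges are increments of a
    primitive and add up to 0. *)
Lemma tri_affine a b n A B C : tri (fun z => a + b * z) n A B C = 0.
Proof. by rewrite /tri /edge !dmean_affine; field. Qed.

Lemma triD f g n A B C :
  tri (fun z => f z + g z) n A B C = tri f n A B C + tri g n A B C.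
Proof. by rewrite /tri /edge !dmeanD; ring. Qed.

Lemma normc_tri_le K g n A B C (M D : R) : midconvex K -> K A -> K B -> K C ->
  normc (B - A) <= D -> normc (C - B) <= D -> normc (A - C) <= D ->
  (forall z, K z -> normc (g z) <= M) -> normc (tri g n A B C) <= 3 * (D * M).
Proof.
move=> Kc KA KB KC AB BC CA gM.
have H A' B' : K A' -> K B' -> normc (B' - A') <= D -> normc (edge g n A' B') <= D * M.
  move=> KA' KB' AB'; rewrite normcM ler_pM ?normc_ge0 //.
  exact: (@normc_dmean_le K).
have := H _ _ KA KB AB; have := H _ _ KB KC BC; have := H _ _ KC KA CA.
have := ler_normcD (edge g n A B) (edge g n B C).
have := ler_normcD (edge g n A B + edge g n B C) (edge g n C A).
rewrite /tri; lra.
Qed.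

End DyadicMean.

Section Goursat.
Variable R : realType.
Variables (g : R[i] -> R[i]) (b : R).
Hypothesis g_diff : forall z, complex.Re z <= b -> exists l, cderiv g z l.
Implicit Types (A B C z : R[i]).

Let inH z := complex.Re z <= b.

(* If the trapezoid sums around a triangle exceed d for infinitely many n, those
   around one of its four quarters exceed d / 4 for infinitely many n. *)
Let persists A B C (d : R) :=
  forall N, exists2 n, (N <= n)%N & d < normc (tri g n A B C).

(** A state is a triangle with the number of bisections made: lengths are divided by 2 each time,
    trapezoid sums by at most 4. *)
Let good (x : (R[i] * R[i] * R[i]) * nat) (d D : R) :=
  [/\ [/\ inH x.1.1.1, inH x.1.1.2 & inH x.1.2],
      [/\ normc (x.1.1.2 - x.1.1.1) <= D / 2 ^+ x.2,
          normc (x.1.2 - x.1.1.2) <= D / 2 ^+ x.2 &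
          normc (x.1.1.1 - x.1.2) <= D / 2 ^+ x.2] &
      persists x.1.1.1 x.1.1.2 x.1.2 (d / 4 ^+ x.2)].

Let not_persists A B C d : ~ persists A B C d ->
  exists N, forall n, (N <= n)%N -> normc (tri g n A B C) <= d.
Proof.
move=> /existsNP[N H]; exists N => n Nn; rewrite leNgt; apply/negP => dn.
by apply: H; exists n.
Qed.

Let persists_quarter A B C d : persists A B C d ->
  [\/ persists A ((A + B) / 2) ((C + A) / 2) (d / 4),
      persists ((A + B) / 2) B ((B + C) / 2) (d / 4),
      persists ((C + A) / 2) ((B + C) / 2) C (d / 4) |
      persists ((A + B) / 2) ((B + C) / 2) ((C + A) / 2) (d / 4)].
Proof.
move=> H.
have [?|/not_persists[N1 H1]] := pselect (persists A ((A + B) / 2) ((C + A) / 2) (d / 4)).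
  by constructor 1.
have [?|/not_persists[N2 H2]] := pselect (persists ((A + B) / 2) B ((B + C) / 2) (d / 4)).
  by constructor 2.
have [?|/not_persists[N3 H3]] := pselect (persists ((C + A) / 2) ((B + C) / 2) C (d / 4)).
  by constructor 3.
have [?|/not_persists[N4 H4]] := pselect (persists ((A + B) / 2) ((B + C) / 2) ((C + A) / 2) (d / 4)).
  by constructor 4.
exfalso.
(* The successor is taken because [triS] lowers the level by one. *)
have [[//|n]] := H (maxn (maxn N1 N2) (maxn N3 N4)).+1.
rewrite ltnS !geq_max => /andP[/andP[/H1 {}H1 /H2 {}H2] /andP[/H3 {}H3 /H4 {}H4]].
rewrite triS ltNge => /negP; apply.
move: H1 H2 H3 H4; set x1 := tri _ _ _ _ _; set x2 := tri _ _ _ _ _.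
set x3 := tri _ _ _ _ _; set x4 := tri _ _ _ _ _.
have := ler_normcD x1 x2; have := ler_normcD (x1 + x2) x3.
have := ler_normcD (x1 + x2 + x3) x4; lra.
Qed.

(** Stated as an implication so that every state has a successor, as dependent choice demands. *)
Let next d D x y := good x d D -> [/\ good y d D, y.2 = x.2.+1 &
  normc (y.1.1.1 - x.1.1.1) <= D / 2 ^+ x.2].

Let next_ex d D x : {y | next d D x y}.
Proof.
apply: cid; have [gx|ngx] := pselect (good x d D); last by exists x => /ngx.
move: gx; case: x => [[[A B] C] k] [/= [HA HB HC] [AB BC CA] P].
have E4 : d / 4 ^+ k.+1 = d / 4 ^+ k / 4.
  by rewrite exprS invfM mulrA mulrAC.
have E2 : D / 2 ^+ k.+1 = D / 2 ^+ k / 2.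
  by rewrite exprS invfM mulrA mulrAC.
have hc := @halfplane_midconvex R b.
have [h1 h2 h3] : [/\ inH ((A + B) / 2), inH ((B + C) / 2) & inH ((C + A) / 2)].
  by split; apply: hc.
have D0 : 0 <= D / 2 ^+ k by exact: le_trans (normc_ge0 _) AB.
have hAB u v : u - v = (A - B) / 2 \/ u - v = (B - A) / 2 ->
    normc (u - v) <= D / 2 ^+ k / 2.
  by case=> ->; rewrite normc_half ler_pM2r // normcB.
have hBC u v : u - v = (B - C) / 2 \/ u - v = (C - B) / 2 ->
    normc (u - v) <= D / 2 ^+ k / 2.
  by case=> ->; rewrite normc_half ler_pM2r // normcB.
have hCA u v : u - v = (C - A) / 2 \/ u - v = (A - C) / 2 ->
    normc (u - v) <= D / 2 ^+ k / 2.
  by case=> ->; rewrite normc_half ler_pM2r // normcB.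
have w : D / 2 ^+ k / 2 <= D / 2 ^+ k by lra.
have [P1|P1|P1|P1] := persists_quarter P.
- exists (A, (A + B) / 2, (C + A) / 2, k.+1) => _.
  split => //; last by rewrite subrr normc0.
  split => //=; last by rewrite E4.
  by rewrite E2; split; [apply: hAB; right|apply: hBC; right|apply: hCA; right]; field.
- exists ((A + B) / 2, B, (B + C) / 2, k.+1) => _.
  split => //; last first.
    by apply: le_trans w; apply: hAB; right => /=; field.
  split => //=; last by rewrite E4.
  by rewrite E2; split; [apply: hAB; right|apply: hBC; right|apply: hCA; right]; field.
- exists ((C + A) / 2, (B + C) / 2, C, k.+1) => _.
  split => //; last first.
    by apply: le_trans w; apply: hCA; left => /=; field.
  split => //=; last by rewrite E4.
  by rewrite E2; split; [apply: hAB; right|apply: hBC; right|apply: hCA; right]; field.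
- exists ((A + B) / 2, (B + C) / 2, (C + A) / 2, k.+1) => _.
  split => //; last first.
    by apply: le_trans w; apply: hAB; right => /=; field.
  split => //=; last by rewrite E4.
  by rewrite E2; split; [apply: hCA; left|apply: hAB; left|apply: hBC; left]; field.
Qed.

Lemma goursat_triangle A B C (d : R) : inH A -> inH B -> inH C -> 0 < d ->
  exists N, forall n, (N <= n)%N -> normc (tri g n A B C) <= d.
Proof.
move=> HA HB HC d0; apply: not_persists => P.
pose D := normc (B - A) + normc (C - B) + normc (A - C).
have D0 : 0 <= D by rewrite !addr_ge0 ?normc_ge0.
have good0 : good (A, B, C, 0%N) d D.
  split => //=; rewrite !expr0 !divr1 //.
  move: (normc_ge0 (B - A)) (normc_ge0 (C - B)) (normc_ge0 (A - C)).
  by rewrite /D => ? ? ?; split; lra.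
have [x [x0 xS]] := dependent_choice (@next_ex d D) (A, B, C, 0%N).
have gx k : good (x k) d D /\ (x k).2 = k.
  elim: k => [|k [IH1 IH2]]; first by rewrite x0.
  by have [? -> _] := xS k IH1; rewrite IH2.
pose a k := (x k).1.1.1.
have aS k : normc (a k.+1 - a k) <= D / 2 ^+ k.
  by have [g1 g2] := gx k; have [_ _] := xS k g1; rewrite g2.
(* The first vertices move by at most D / 2^k at step k; the geometric sum makes them a Cauchy
   sequence, whose limit z is the point common to the nested triangles. *)
have aD k i : normc (a (k + i)%N - a k) <= 2 * (D / 2 ^+ k) * (1 - 2^-1 ^+ i).
  elim: i => [|i IH]; first by rewrite addn0 !subrr mulr0 normc0.
  rewrite (le_trans (ler_dist_normcD (a (k + i)%N) _ _)) // addnS.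
  have := aS (k + i)%N; rewrite (_ : D / 2 ^+ (k + i) = D / 2 ^+ k * 2^-1 ^+ i).
    rewrite [2^-1 ^+ i.+1]exprS.
    by move: IH; set u := D / 2 ^+ k; set v := 2^-1 ^+ i; lra.
  by rewrite exprD invfM exprVn mulrA.
have pow2 k : 0 < 2 ^+ k :> R by rewrite exprn_gt0.
have aD2 k j : (k <= j)%N -> normc (a j - a k) <= 2 * (D / 2 ^+ k).
  move=> /subnKC <-; apply: le_trans (aD _ _) _.
  have u0 : 0 <= D / 2 ^+ k by rewrite divr_ge0 // ltW.
  have v0 : 0 <= 2^-1 ^+ (j - k) :> R by rewrite exprn_ge0 // invr_ge0.
  by have := mulr_ge0 u0 v0; lra.
have ba : ev_bounded a.
  exists (2 * (D / 2 ^+ 0) + normc (a 0%N)), 0%N => n /aD2 H.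
  rewrite -(subrK (a 0%N) (a n)) (le_trans (ler_normcD _ _)) //.
  by rewrite lerD2r.
pose z := ulim a.
have za k : normc (a k - z) <= 2 * (D / 2 ^+ k).
  rewrite normcB /z -{1}(ulim_cst (a k)) -ulimB //; last exact: ev_bounded_cst.
  by apply: ulim_le; exists k => n /aD2.
have Hz : inH z.
  by apply: Re_ulim_le => //; exists 0%N => k _; have [[[]]] := gx k.
have [l gl] := g_diff Hz.
(* The final estimate is 9 D^2 e / 4^k, to be kept below d / 4^k; the 1 covers D = 0. *)
pose e := d / (9 * D ^+ 2 + 1).
have D9 : 0 < 9 * D ^+ 2 + 1 by rewrite ltr_wpDl // mulr_ge0 // sqr_ge0.
have [r r0 gr] := gl e (divr_gt0 d0 D9).
have [k kr] : exists k, 3 * (D / 2 ^+ k) < r.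
  have := archi_boundP (divr_ge0 (mulr_ge0 (ler0n R 3) D0) (ltW r0)).
  set k := Num.bound _ => kD; exists k.
  rewrite mulrA ltr_pdivrMr // -ltr_pdivrMl // mulrC (lt_trans kD) //.
  by rewrite -natrX ltr_nat ltn_expl.
have [[[HA' HB' HC'] [AB BC CA] P'] E] := gx k; move: AB BC CA P'.
rewrite {}E; have := za k; rewrite /a; case: (x k) HA' HB' HC' => [[[A' B'] C'] ?] /=.
move=> {P}HA' HB' HC' zA AB BC CA /(_ 0%N)[n _].
set u := D / 2 ^+ k in kr zA AB BC CA *.
have u0 : 0 <= u by rewrite divr_ge0 // ltW.
rewrite ltNge => /negP; apply.
(* The affine part of g at z contributes nothing. The first vertex is within 2 u of z and sides are
   at most u, so the remainder is at most 3 e u on the ball of radius 3 u, which contains the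
   triangle. *)
have E : tri g n A' B' C' =
    tri (fun w => g z - l * z + l * w) n A' B' C' +
    tri (fun w => g w - g z - l * (w - z)) n A' B' C'.
  by rewrite -triD; congr tri; apply/funext => w; ring.
rewrite E tri_affine add0r.
have gK w : normc (w - z) <= 3 * u -> normc (g w - g z - l * (w - z)) <= e * (3 * u).
  move=> wz; have := gr (w - z) (le_lt_trans wz kr).
  rewrite (_ : z + (w - z) = w); last by rewrite addrC subrK.
  move=> /le_trans; apply; rewrite ler_wpM2l // ltW // divr_gt0 //.
have KA : normc (A' - z) <= 3 * u by lra.
have KB : normc (B' - z) <= 3 * u by have := ler_dist_normcD A' B' z; lra.
have KC : normc (C' - z) <= 3 * u.
  by have := ler_dist_normcD A' C' z; rewrite (normcB C' A'); lra.
rewrite (le_trans (normc_tri_le n (@ball_midconvex R z (3 * u)) KA KB KC AB BC CA gK)) //.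
have -> : 4 ^+ k = (2 ^+ k) ^+ 2 :> R.
  by rewrite exprAC; congr (_ ^+ k); rewrite expr2 -natrM.
have -> : 3 * (u * (e * (3 * u))) = (9 * D ^+ 2 * e) / (2 ^+ k) ^+ 2.
  rewrite /u; move: (2 ^+ k) (pow2 k) => p /lt0r_neq0 p0.
  by field.
rewrite ler_pM2r ?invr_gt0 ?exprn_gt0 // /e mulrA ler_pdivrMr // mulrC.
by rewrite ler_pM2l // lerDl.
Qed.

End Goursat.

(** * Means over circles and Fourier coefficients *)

Section CircleMean.
Variable R : realType.
Implicit Types (f g h : R[i] -> R[i]) (z : R[i]) (s : R) (j k : int).

(** [cexp] maps this segment onto the circle of radius exp s, which lies in the unit disk when s <
    0. Thus [cmean s] of f o [cexp] is a mean of f over that circle. *)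
Definition seg s z : Prop := complex.Re z = s /\ 0 <= complex.Im z <= pi *+ 2.

Lemma seg_midconvex s : midconvex (seg s).
Proof.
move=> A B [As /andP[A1 A2]] [Bs /andP[B1 B2]]; split.
  by apply: line_midconvex.
rewrite cImM (_ : 2^-1 = (2^-1)%:C :> R[i]) /= ?mulr0 ?add0r; last first.
  by rewrite fmorphV rmorph_nat.
by rewrite cImD; apply/andP; split; lra.
Qed.

Lemma seg_left s : seg s s%:C.
Proof. by split => //=; rewrite lexx mulrn_wge0 // pi_ge0. Qed.

Lemma seg_right s : seg s (s%:C + i2pi R).
Proof.
split; first by rewrite /= addr0.
by rewrite /= add0r lexx mulrn_wge0 // pi_ge0.
Qed.

Definition cmean s g := ulim (fun n => dmean g n s%:C (s%:C + i2pi R)).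

Definition seg_bounded s g := exists M : R, forall z, seg s z -> normc (g z) <= M.

Lemma seg_bounded_ev s g : seg_bounded s g ->
  ev_bounded (fun n => dmean g n s%:C (s%:C + i2pi R)).
Proof.
move=> [M gM]; exists M, 0%N => n _.
exact: (normc_dmean_le n (@seg_midconvex s) (seg_left s) (seg_right s) gM).
Qed.

Lemma seg_boundedD s f g : seg_bounded s f -> seg_bounded s g ->
  seg_bounded s (fun z => f z + g z).
Proof.
move=> [M fM] [N gN]; exists (M + N) => z sz.
by rewrite (le_trans (ler_normcD _ _)) // lerD ?fM ?gN.
Qed.

Lemma seg_boundedM s f g : seg_bounded s f -> seg_bounded s g ->
  seg_bounded s (fun z => f z * g z).
Proof.
move=> [M fM] [N gN]; exists (M * N) => z sz.
by rewrite normcM ler_pM ?normc_ge0 ?fM ?gN.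
Qed.

Lemma seg_bounded_cst s c : seg_bounded s (fun=> c).
Proof. by exists (normc c). Qed.

Lemma seg_boundedZ s c g : seg_bounded s g -> seg_bounded s (fun z => c * g z).
Proof. exact/seg_boundedM/seg_bounded_cst. Qed.

Lemma seg_bounded_conj s g : seg_bounded s g -> seg_bounded s (fun z => conjc (g z)).
Proof. by move=> [M gM]; exists M => z /gM; rewrite normc_conj. Qed.

Lemma cmeanD s f g : seg_bounded s f -> seg_bounded s g ->
  cmean s (fun z => f z + g z) = cmean s f + cmean s g.
Proof.
move=> bf bg; rewrite /cmean; under eq_fun do rewrite dmeanD.
by rewrite ulimD //; exact: seg_bounded_ev.
Qed.

Lemma cmeanZ s c g : seg_bounded s g ->
  cmean s (fun z => c * g z) = c * cmean s g.
Proof.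
move=> bg; rewrite /cmean; under eq_fun do rewrite dmeanZ.
by rewrite ulimZ //; exact: seg_bounded_ev.
Qed.

Lemma cmean_cst s c : cmean s (fun=> c) = c.
Proof.
rewrite /cmean -[RHS]ulim_cst; apply: eq_ulim => n.
rewrite -[RHS](addr0 c) -(mul0r ((s%:C + (s%:C + i2pi R)) / 2)).
by rewrite -(dmean_affine _ _ n); congr dmean; apply/funext => z; rewrite mul0r addr0.
Qed.

Lemma eq_cmean s f g : (forall z, seg s z -> f z = g z) -> cmean s f = cmean s g.
Proof.
move=> fg; apply: eq_ulim => n.
exact: (eq_dmean n (@seg_midconvex s) (seg_left s) (seg_right s)).
Qed.

Lemma cmeanB s f g : seg_bounded s f -> seg_bounded s g ->
  cmean s (fun z => f z - g z) = cmean s f - cmean s g.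
Proof.
move=> bf bg; rewrite -mulN1r -cmeanZ // -cmeanD //; last exact: seg_boundedZ.
by apply: eq_cmean => z _; rewrite mulN1r.
Qed.

Lemma normc_cmean_le s g (M : R) : (forall z, seg s z -> normc (g z) <= M) ->
  normc (cmean s g) <= M.
Proof.
move=> gM; apply: ulim_le; exists 0%N => n _.
exact: (normc_dmean_le n (@seg_midconvex s) (seg_left s) (seg_right s) gM).
Qed.

Lemma cmean_ge0 s g : seg_bounded s g -> (forall z, seg s z -> 0 <= g z) ->
  0 <= cmean s g.
Proof.
move=> bg g0; apply: ulim_ge0; first exact: seg_bounded_ev.
by move=> n; exact: (dmean_ge0 n (@seg_midconvex s) (seg_left s) (seg_right s)).
Qed.

Lemma cmean_conj s g : seg_bounded s g ->
  cmean s (fun z => conjc (g z)) = conjc (cmean s g).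
Proof.
move=> bg; rewrite /cmean; under eq_fun do rewrite dmean_conj.
by rewrite ulim_conj //; exact: seg_bounded_ev.
Qed.

(* Goursat on the two triangles of the rectangle with vertical sides
   Re = s and Re = s'; the horizontal sides cancel by periodicity. *)
Lemma cmean_indep s s' g :
  (forall z, complex.Re z <= Num.max s s' -> exists l, cderiv g z l) ->
  (forall z, g (z + i2pi R) = g z) ->
  seg_bounded s g -> seg_bounded s' g -> cmean s g = cmean s' g.
Proof.
move=> gd gper bs bs'; apply/eqP; rewrite -subr_eq0; apply/eqP.
rewrite -ulimB; [|exact: seg_bounded_ev..]; apply: cvg_ulim => e e0.
have p0 : 0 < normc (i2pi R).
  by rewrite normc_gt0 eq_complex /= eqxx /= mulrn_eq0 /= gt_eqF // pi_gt0.
(* Half of the tolerance for each triangle; the factor |2 pi i| converts edge sums to means. *)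
have d0 : 0 < e * normc (i2pi R) / 2 by rewrite divr_gt0 // mulr_gt0.
have Hl (u : R) (v : R[i]) : (u = s \/ u = s') -> (v = 0 \/ v = i2pi R) ->
    complex.Re (u%:C + v) <= Num.max s s'.
  by move=> [->|->] [->|->]; rewrite cReD /= addr0 le_max lexx ?orbT.
have [N1 H1] := goursat_triangle gd (A := s%:C + 0) (B := s%:C + i2pi R)
  (C := s'%:C + i2pi R) (Hl _ _ (or_introl erefl) (or_introl erefl))
  (Hl _ _ (or_introl erefl) (or_intror erefl))
  (Hl _ _ (or_intror erefl) (or_intror erefl)) d0.
have [N2 H2] := goursat_triangle gd (A := s%:C + 0) (B := s'%:C + i2pi R)
  (C := s'%:C + 0) (Hl _ _ (or_introl erefl) (or_introl erefl))
  (Hl _ _ (or_intror erefl) (or_intror erefl))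
  (Hl _ _ (or_intror erefl) (or_introl erefl)) d0.
exists (maxn N1 N2) => n; rewrite geq_max => /andP[/H1 {}H1 /H2 {}H2].
rewrite subr0 -(ler_pM2r p0) -normcM.
rewrite (_ : _ * i2pi R = tri g n (s%:C + 0) (s%:C + i2pi R) (s'%:C + i2pi R) +
   tri g n (s%:C + 0) (s'%:C + i2pi R) (s'%:C + 0)).
  by rewrite (le_trans (ler_normcD _ _)) //; lra.
rewrite !addr0 /tri (edgeC g n s%:C s'%:C) (edgeC g n s%:C (s'%:C + i2pi R)).
rewrite (edgeC g n s'%:C (s'%:C + i2pi R)).
have -> : edge g n (s%:C + i2pi R) (s'%:C + i2pi R) = edge g n s%:C s'%:C.
  rewrite /edge dmean_shift; have -> : (fun z => g (z + i2pi R)) = g.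
    by apply/funext => z; rewrite gper.
  by congr (_ * _); ring.
by rewrite /edge; ring.
Qed.

End CircleMean.

(** * Fourier coefficients on vertical segments and Bessel's inequality *)

Section Fourier.
Variable R : realType.
Implicit Types (f g h : R[i] -> R[i]) (z : R[i]) (s : R) (i j k : int).

(** The power of exponent j, of either sign, in the coordinate exp z. *)
Definition cexpz j z : R[i] := cexp (j%:~R * z).

Lemma cexpzD i j z : cexpz (i + j) z = cexpz i z * cexpz j z.
Proof. by rewrite /cexpz intrD mulrDl cexpD. Qed.

Lemma cexpz0 z : cexpz 0 z = 1.
Proof. by rewrite /cexpz mul0r cexp0. Qed.

Lemma cexpz1 z : cexpz 1 z = cexp z.
Proof. by rewrite /cexpz mul1r. Qed.

Lemma normc_cexpz j z : normc (cexpz j z) = expR (j%:~R * complex.Re z).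
Proof.
rewrite normc_cexp -(rmorph_int (real_complex R)) cReM /=.
by rewrite mul0r subr0.
Qed.

Lemma cderiv_cexpz j z : exists l, cderiv (cexpz j) z l.
Proof. by eexists; exact: cderiv_cexpZ. Qed.

Lemma cexp_int k : cexp (k%:~R * i2pi R) = 1.
Proof.
case: k => n; first by rewrite cexpMn cexp_i2pi expr1n.
by rewrite NegzE mulrNz mulNr cexpN cexpMn cexp_i2pi expr1n invr1.
Qed.

Lemma cexpz_i2pi j z : cexpz j (z + i2pi R) = cexpz j z.
Proof. by rewrite /cexpz mulrDr cexpD cexp_int mulr1. Qed.

Lemma seg_bounded_cexpz s j : seg_bounded s (cexpz j).
Proof. by exists (expR (j%:~R * s)) => z [<- _]; rewrite normc_cexpz. Qed.

Lemma cexpz_conj s j z : complex.Re z = s ->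
  conjc (cexpz j z) = (expR (j%:~R * s *+ 2))%:C * cexpz (- j) z.
Proof.
move=> zs; apply: (mulfI (cexp_neq0 (j%:~R * z))).
rewrite -/(cexpz j z) mulcJ mulrCA -cexpzD subrr cexpz0 mulr1.
by rewrite normc_cexpz zs mulr2n expRD expr2.
Qed.

(* Moving the line by -1 multiplies the mean by exp (- j), but the mean does not
   depend on the line. *)
Lemma cmean_cexpz s j : cmean s (cexpz j) = (j == 0)%:R.
Proof.
have [->|j0] := eqVneq j 0.
  by rewrite -[RHS](cmean_cst s); apply: eq_cmean => z _; rewrite cexpz0.
have E : cmean (s - 1) (cexpz j) = cexp (- j%:~R) * cmean s (cexpz j).
  rewrite -cmeanZ; last exact: seg_bounded_cexpz.
  apply: eq_ulim => n.
  have -> : (s - 1)%:C = s%:C + (- 1) by rewrite rmorphB rmorph1.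
  rewrite addrAC dmean_shift; congr dmean; apply/funext => z.
  by rewrite /cexpz mulrDr mulrN1 cexpD mulrC.
have H : cmean s (cexpz j) = cmean (s - 1) (cexpz j).
  apply: cmean_indep; [|exact: cexpz_i2pi|exact: seg_bounded_cexpz..].
  by move=> z _; exact: cderiv_cexpz.
have /eqP : (1 - cexp (- j%:~R)) * cmean s (cexpz j) = 0.
  by rewrite mulrBl mul1r -E H subrr.
rewrite mulf_eq0 => /orP[|/eqP //]; rewrite subr_eq0 => /eqP /(congr1 (@normc R)).
rewrite normc_cexp normc1 -expR0 -(rmorph_int (real_complex R)) -rmorphN /=.
by move=> /expR_inj /eqP; rewrite eq_sym oppr_eq0 intr_eq0 (negPf j0).
Qed.

(** The power [cexpz j] divided by its modulus on the line Re z = s; on that line these functions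
    are orthonormal for [cmean s]. *)
Definition expn_line s j z : R[i] := cexpz j (z - s%:C).

Lemma expn_lineE s j z : expn_line s j z = (expR (- (j%:~R * s)))%:C * cexpz j z.
Proof.
rewrite /expn_line /cexpz mulrBr cexpD mulrC; congr (_ * _).
rewrite /cexp -(rmorph_int (real_complex R)) /= !mul0r !mulr0 subr0 addr0.
by rewrite oppr0 cos0 sin0 mulr1 mulr0.
Qed.

Lemma expn_lineD s i j z :
  expn_line s (i + j) z = expn_line s i z * expn_line s j z.
Proof. exact: cexpzD. Qed.

Lemma expn_line_conj s j z : complex.Re z = s ->
  conjc (expn_line s j z) = expn_line s (- j) z.
Proof.
move=> zs; rewrite /expn_line (@cexpz_conj 0) ?mulr0 ?mul0rn ?expR0 ?mul1r //.
by rewrite cReD zs /= subrr.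
Qed.

Lemma normc_expn_line s j z : complex.Re z = s -> normc (expn_line s j z) = 1.
Proof. by move=> zs; rewrite normc_cexpz cReD zs /= subrr mulr0 expR0. Qed.

Lemma seg_bounded_expn_line s j : seg_bounded s (expn_line s j).
Proof. by exists 1 => z [zs _]; rewrite normc_expn_line. Qed.

Lemma cmean_expn_line s j : cmean s (expn_line s j) = (j == 0)%:R.
Proof.
have -> : expn_line s j = fun z => (expR (- (j%:~R * s)))%:C * cexpz j z.
  by apply/funext => z; exact: expn_lineE.
rewrite cmeanZ; last exact: seg_bounded_cexpz.
rewrite cmean_cexpz; have [->|_] := eqVneq j 0; last by rewrite mulr0.
by rewrite mul0r oppr0 expR0 mulr1.
Qed.

Definition fourier s h j : R[i] := cmean s (fun z => h z * expn_line s (- j) z).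

(** Induction on the list: removing from h its component along the first index leaves the other
    coefficients unchanged and lowers the mean of |h|^2 by exactly |a|^2. Positivity of the mean
    ends the induction. *)
Lemma bessel s h (js : seq int) : seg_bounded s h -> uniq js ->
  \sum_(j <- js) normc (fourier s h j) ^+ 2 <=
    complex.Re (cmean s (fun z => h z * conjc (h z))).
Proof.
elim: js h => [|j js IH] h bh.
  rewrite big_nil => _.
  have : 0 <= cmean s (fun z => h z * conjc (h z)).
    apply: cmean_ge0; first exact/seg_boundedM/seg_bounded_conj.
    by move=> z _; exact: mulcJ_ge0.
  by rewrite lecE => /andP[].
move=> /= /andP[jjs ujs]; rewrite big_cons.
set a := fourier s h j.
pose h' z := h z - a * expn_line s j z.
have bE k : seg_bounded s (expn_line s k) by exact: seg_bounded_expn_line.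
have baE k c : seg_bounded s (fun z => c * expn_line s k z) by exact: seg_boundedZ.
have bh' : seg_bounded s h'.
  have [M hM] := bh; have [N aN] := baE j a; exists (M + N) => z sz.
  by rewrite (le_trans (ler_normcB _ _)) // lerD ?hM ?aN.
have F k : k \in js -> fourier s h' k = fourier s h k.
  move=> kjs; have kj : j - k != 0.
    by rewrite subr_eq0; apply: contraNneq jjs => ->.
  rewrite /fourier (_ : cmean s (fun z => h' z * _) =
    cmean s (fun z => h z * expn_line s (- k) z - a * expn_line s (j - k) z)).
    rewrite cmeanB ?cmeanZ ?cmean_expn_line ?(negPf kj) ?mulr0 ?subr0 //.
    exact: seg_boundedM.
  by apply: eq_cmean => z _; rewrite expn_lineD /h'; ring.
have {IH} := IH h' bh' ujs.
under eq_big_seq => k kjs do rewrite F //.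
suff -> : cmean s (fun z => h' z * conjc (h' z)) =
    cmean s (fun z => h z * conjc (h z)) - (normc a ^+ 2)%:C.
  by rewrite -rmorphN cReD /= lerBrDl.
have bh1 : seg_bounded s (fun z => h z * conjc (h z)).
  exact/seg_boundedM/seg_bounded_conj.
have bh2 : seg_bounded s (fun z => h z * expn_line s (- j) z).
  exact: seg_boundedM.
rewrite (_ : cmean s _ = cmean s (fun z => (h z * conjc (h z) +
   (- conjc a) * (h z * expn_line s (- j) z)) +
   (- a * conjc (h z * expn_line s (- j) z : R[i]) + a * conjc a))); last first.
  have JM (x y : R[i]) : conjc (x * y : R[i]) = conjc x * conjc y by exact: rmorphM.
  have JB (x y : R[i]) : conjc (x - y : R[i]) = conjc x - conjc y by exact: rmorphB.
  apply: eq_cmean => z [zs _]; rewrite /h' JB !JM !expn_line_conj // opprK.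
  have E : expn_line s j z * expn_line s (- j) z = 1.
    by rewrite -expn_lineD subrr /expn_line cexpz0.
  transitivity (h z * conjc (h z) - conjc a * (h z * expn_line s (- j) z)
     - a * (conjc (h z) * expn_line s j z)
     + a * conjc a * (expn_line s j z * expn_line s (- j) z)).
    by ring.
  by rewrite E mulr1; ring.
have bc := seg_bounded_cst s (a * conjc a).
have bh3 := seg_bounded_conj bh2.
have bh4 := seg_boundedZ (- conjc a) bh2.
have bh5 := seg_boundedZ (- a) bh3.
rewrite cmeanD; [|exact: seg_boundedD bh1 bh4|exact: seg_boundedD bh5 bc].
rewrite (cmeanD bh1 bh4) (cmeanD bh5 bc) (cmeanZ _ bh2) (cmeanZ _ bh3).
rewrite (cmean_conj bh2) cmean_cst.
rewrite -/(fourier s h j) -/a -mulcJ; ring.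
Qed.

Lemma bessel_bound s h (M : R) (js : seq int) : uniq js ->
  (forall z, seg s z -> normc (h z) <= M) ->
  \sum_(j <- js) normc (fourier s h j) ^+ 2 <= M ^+ 2.
Proof.
move=> ujs hM; apply: le_trans (bessel _ ujs) _; first by exists M.
apply: le_trans (Re_le_normc _) _; apply: normc_cmean_le => z sz.
by rewrite normcM normc_conj expr2 ler_pM ?normc_ge0 ?hM.
Qed.

(** The Riemann-Lebesgue lemma: by Bessel the squared moduli form a convergent series, so they tend
    to 0. *)
Lemma fourier_cvg0 s h : seg_bounded s h -> forall e : R, 0 < e ->
  exists N, forall n : nat, (N <= n)%N -> normc (fourier s h n%:Z) <= e.
Proof.
move=> [M hM] e e0.
pose u (n : nat) := normc (fourier s h n%:Z) ^+ 2.
have : cvgn (series u).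
  apply: nondecreasing_is_cvgn.
    by apply/nondecreasing_seqP => n; rewrite seriesSr lerDl sqr_ge0.
  exists (M ^+ 2) => _ [n _ <-]; rewrite /series /=.
  rewrite -(big_map Posz xpredT (fun k => normc (fourier s h k) ^+ 2)).
  apply: bessel_bound => //; rewrite map_inj_uniq ?iota_uniq //.
  by move=> i j [].
move=> /cvg_series_cvg_0 /cvgrPdist_le /(_ (e ^+ 2) (exprn_gt0 _ e0)).
move=> [N _ H]; exists N => n /H; rewrite sub0r normrN ger0_norm ?sqr_ge0 //.
by rewrite ler_pXn2r ?nnegrE ?normc_ge0 // ltW.
Qed.

End Fourier.

(** * Taylor expansion of analytic functions *)

Section LaurentCoefficients.
Variable R : realType.
Variable f : R[i] -> R[i].
Hypothesis f_analytic : analytic_on_disk f.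
Implicit Types (z a : R[i]) (s : R) (j k : int).

Lemma unit_disk_cexp z : unit_disk (cexp z) <-> complex.Re z < 0.
Proof. by rewrite unit_diskE normc_cexp expR_lt1. Qed.

Lemma analytic_cexp_cderiv z : complex.Re z < 0 ->
  exists l, cderiv (fun w => f (cexp w)) z l.
Proof.
move=> /unit_disk_cexp /f_analytic /cderiv_derive1 fl.
by eexists; apply: (cderiv_comp fl); exact: cderiv_cexp.
Qed.

(** Differentiability makes t |-> |f (exp (s + i t))| continuous, and the extreme value theorem
    applies on [0, 2 pi]. *)
Lemma seg_bounded_analytic s : s < 0 -> seg_bounded s (fun z => f (cexp z)).
Proof.
move=> s0; pose phi t := normc (f (cexp (s +i* t))).
have phic : continuous phi.
  move=> t; have [l /cderiv_lipschitz[d d0 H]] :=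
    @analytic_cexp_cderiv (s +i* t) s0.
  have l1 : 0 < normc l + 1 by rewrite ltr_wpDl ?normc_ge0.
  apply/cvgrPdist_le => e e0; exists (Num.min d (e / (normc l + 1))).
    by rewrite /= lt_min d0 divr_gt0.
  move=> u /=; rewrite distrC lt_min => /andP[ud ue].
  have hu : s +i* u = (s +i* t) + 0 +i* (u - t).
    by apply/eqP; rewrite eq_complex /= addr0 addrC subrK !eqxx.
  have nu : normc (0 +i* (u - t) : R[i]) = `|u - t|.
    by rewrite /normc /= expr0n add0r sqrtr_sqr.
  apply: (@le_trans _ _ (normc (f (cexp (s +i* u)) - f (cexp (s +i* t))))).
    rewrite /phi ler_norml lerBlDr lerNl opprB lerBlDr.
    apply/andP; split.
      by rewrite (le_trans _ (ler_normcD _ _)) // subrK.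
    by rewrite normcB (le_trans _ (ler_normcD _ _)) // subrK.
  by rewrite hu (le_trans (H _ _)) ?nu // mulrC -ler_pdivlMr // ltW.
have pi20 : 0 <= pi *+ 2 :> R by rewrite mulrn_wge0 // pi_ge0.
have [c _ H] := EVT_max pi20 (continuous_subspaceT phic).
exists (phi c) => -[x y] [/= -> y2]; apply: H; by rewrite in_itv.
Qed.

(** The line Re z = -1 is an arbitrary choice: by [laurentE] every s < 0 gives the same value. *)
Definition laurent k : R[i] := cmean (-1) (fun z => f (cexp z) * cexpz (- k) z).

Lemma laurentE s k : s < 0 ->
  cmean s (fun z => f (cexp z) * cexpz (- k) z) = laurent k.
Proof.
move=> s0; apply: cmean_indep.
- move=> z zs; have z0 : complex.Re z < 0.
    by rewrite (le_lt_trans zs) // gt_max s0 oppr_lt0 ltr01.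
  have [l fl] := analytic_cexp_cderiv z0; have [m gm] := cderiv_cexpz (- k) z.
  by eexists; exact: cderivM fl gm.
- by move=> z; rewrite cexpz_i2pi cexpD cexp_i2pi mulr1.
- exact/seg_boundedM/seg_bounded_cexpz/seg_bounded_analytic.
- apply: seg_boundedM; last exact: seg_bounded_cexpz.
  by apply: seg_bounded_analytic; rewrite oppr_lt0 ltr01.
Qed.

(** Cauchy's estimate on the circle of radius exp s. *)
Lemma laurent_le s k (M : R) : s < 0 ->
  (forall z, seg s z -> normc (f (cexp z)) <= M) ->
  normc (laurent k) * expR (k%:~R * s) <= M.
Proof.
move=> s0 fM; rewrite -(laurentE k s0) -ler_pdivlMr ?expR_gt0 // -expRN -mulNr.
apply: normc_cmean_le => z sz; rewrite normcM ler_pM ?normc_ge0 ?fM //.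
by case: sz => <- _; rewrite normc_cexpz mulrNz.
Qed.

(** Differentiability at 0, read in the coordinate exp z: going far to the left means approaching
    0. *)
Lemma analytic_bounded0 : exists M s1 : R, [/\ 0 <= M, s1 <= 0 &
  forall z, complex.Re z < s1 -> normc (f (cexp z) - f 0) <= M * expR (complex.Re z)].
Proof.
have d0 : unit_disk (0 : R[i]) by rewrite unit_diskE normc0 ltr01.
have [d dp H] := cderiv_lipschitz (cderiv_derive1 (f_analytic d0)).
exists (normc (derive1 f 0) + 1), (Num.min (ln d) 0); split.
- by rewrite addr_ge0 ?normc_ge0.
- by rewrite ge_min lexx orbT.
move=> z; rewrite lt_min => /andP[zd _].
have := H (cexp z); rewrite add0r normc_cexp; apply.
by rewrite -[d]lnK ?posrE // ltr_expR.
Qed.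

Lemma expR_small (e M : R) : 0 < e -> 0 <= M -> exists2 s, s < 0 & M * expR s <= e.
Proof.
move=> e0 M0; have M1 : 0 < M + 1 by rewrite ltr_wpDl.
exists (Num.min (-1) (ln (e / (M + 1)))).
  by rewrite gt_min oppr_lt0 ltr01.
apply: (@le_trans _ _ ((M + 1) * (e / (M + 1)))).
  rewrite ler_pM ?expR_ge0 ?lerDl // -[leRHS]lnK ?posrE ?divr_gt0 //.
  by rewrite ler_expR ge_min lexx orbT.
by rewrite mulrC divfK // gt_eqF.
Qed.

(** [Negz n] is -(n + 1), so Cauchy's estimate bounds the coefficient by N exp ((n + 1) s), where N
    bounds f near 0; now s tends to minus infinity. *)
Lemma laurent_neg n : laurent (Negz n) = 0.
Proof.
have [M [s1 [M0 s10 H]]] := analytic_bounded0.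
pose N := normc (f 0) + M.
have N0 : 0 <= N by rewrite addr_ge0 ?normc_ge0.
apply/eqP; rewrite -normc_eq0 eq_le normc_ge0 andbT.
apply/ler_addgt0Pr => e e0; rewrite add0r.
have [s2 s20 He] := expR_small e0 N0.
have [s [s0 ss1 ss2]] : exists s, [/\ s < 0, s < s1 & s <= s2].
  by exists (Num.min (s1 - 1) s2); split; rewrite ?gt_min ?ge_min ?s20 ?lexx
    ?orbT ?ltrBlDr ?ltrDl ?ltr01.
have fN z : seg s z -> normc (f (cexp z)) <= N.
  move=> [zs _]; rewrite -(subrK (f 0) (f (cexp z))) addrC.
  rewrite (le_trans (ler_normcD _ _)) // lerD2l.
  rewrite (le_trans (H _ _)) ?zs // ler_piMr // expR_le1 ltW //.
have := laurent_le (Negz n) s0 fN.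
rewrite -ler_pdivlMr ?expR_gt0 // -expRN => /le_trans; apply.
apply: le_trans _ He; rewrite ler_wpM2l // ler_expR NegzE mulrNz mulNr opprK.
rewrite (le_trans _ ss2) // -[leRHS]mul1r; apply: ler_wnM2r; first exact: ltW.
by rewrite -[_%:~R]/(n.+1%:R) ler1n.
Qed.

Lemma laurent0 : laurent 0 = f 0.
Proof.
have [M [s1 [M0 s10 H]]] := analytic_bounded0.
apply/eqP; rewrite -subr_eq0 -normc_eq0 eq_le normc_ge0 andbT.
apply/ler_addgt0Pr => e e0; rewrite add0r.
have [s2 s20 He] := expR_small e0 M0.
have [s [s0 ss1 ss2]] : exists s, [/\ s < 0, s < s1 & s <= s2].
  by exists (Num.min (s1 - 1) s2); split; rewrite ?gt_min ?ge_min ?s20 ?lexx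
    ?orbT ?ltrBlDr ?ltrDl ?ltr01.
rewrite -(laurentE 0 s0) -(cmean_cst s (f 0)).
rewrite -cmeanB; last 2 first.
- exact/seg_boundedM/seg_bounded_cexpz/seg_bounded_analytic.
- exact: seg_bounded_cst.
apply: normc_cmean_le => z [zs _]; rewrite oppr0 cexpz0 mulr1.
rewrite (le_trans (H _ _)) ?zs // (le_trans _ He) // ler_wpM2l //.
by rewrite ler_expR.
Qed.

(* Chernoff's argument: with f w = f a + (w - a) D w on the circle |w| = |a|,
   the partial sums at a telescope, up to Fourier coefficients of the bounded
   function D. *)
Lemma taylor_cvg a : unit_disk a -> forall e : R, 0 < e ->
  exists N, forall n, (N <= n)%N ->
    normc (\sum_(0 <= k < n) laurent k%:Z * a ^+ k - f a) <= e.
Proof.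
move=> aD e e0; have [->|a0] := eqVneq a 0.
  exists 1%N => -[//|n] _; rewrite big_nat_recl // expr0 mulr1 laurent0.
  rewrite big1 ?addr0 ?subrr ?normc0 ?ltW // => k _.
  by rewrite expr0n mulr0.
have [b ab] := cexp_onto a0; set s := complex.Re b.
have s0 : s < 0 by apply/unit_disk_cexp; rewrite -ab.
have as_ : normc a = expR s by rewrite ab normc_cexp.
(* At w = a division by 0 gives D a = 0; [fD] still holds there because of the factor w - a. *)
pose D w := (f w - f a) / (w - a).
have fD w : f w = f a + (w - a) * D w.
  have [->|wa] := eqVneq w a; first by rewrite subrr mul0r addr0.
  by rewrite /D mulrC divfK ?subr_eq0 // addrC subrK.
have [M fM] := seg_bounded_analytic s0.
have M0 : 0 <= M by apply: le_trans (fM _ (seg_left s)); exact: normc_ge0.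
(* Closer to a than d the Lipschitz constant L bounds the quotient; farther away (M + |f a|) / d
   does. *)
have bD : seg_bounded s (fun z => D (cexp z)).
  have [d d0 H] := cderiv_lipschitz (cderiv_derive1 (f_analytic aD)).
  set L := normc _ + 1 in H.
  have L0 : 0 <= L by rewrite addr_ge0 ?normc_ge0.
  exists (L + (M + normc (f a)) / d) => z sz.
  have F0 : 0 <= (M + normc (f a)) / d by rewrite divr_ge0 ?addr_ge0 ?normc_ge0 ?(ltW d0).
  have [wa|wa] := eqVneq (cexp z) a.
    by rewrite /D wa subrr mul0r normc0 addr_ge0.
  have wa0 : 0 < normc (cexp z - a) by rewrite normc_gt0 subr_eq0.
  rewrite /D normcM normcV ler_pdivrMr //.
  have [wd|wd] := ltP (normc (cexp z - a)) d.
    have := H _ wd; rewrite [a + _]addrC subrK => /le_trans; apply.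
    by rewrite ler_wpM2r ?normc_ge0 // lerDl.
  rewrite (le_trans (ler_normcB _ _)) //.
  apply: (@le_trans _ _ ((M + normc (f a)) / d * d)).
    by rewrite divfK ?gt_eqF // lerD2r fM.
  by rewrite ler_pM ?(ltW d0) // lerDr.
pose m k := cmean s (fun z => D (cexp z) * cexpz (- k) z).
have bm k : seg_bounded s (fun z => D (cexp z) * cexpz (- k) z).
  exact/seg_boundedM/seg_bounded_cexpz.
(* The identity [fD] multiplied by the power -k and averaged; the factor w shifts the index of m by
   one. *)
have cE k : laurent k = f a * (k == 0)%:R + m (k - 1) - a * m k.
  rewrite -(laurentE k s0) -oppr_eq0 -(cmean_cexpz s (- k)).
  rewrite /m -cmeanZ; last exact: seg_bounded_cexpz.
  rewrite -cmeanZ // -cmeanD //; last exact/seg_boundedZ/seg_bounded_cexpz.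
  rewrite -cmeanB; last 2 first.
  - exact/seg_boundedD/bm/seg_boundedZ/seg_bounded_cexpz.
  - exact: seg_boundedZ.
  apply: eq_cmean => z _; rewrite fD opprB [1 - k]addrC cexpzD cexpz1.
  ring.
have mF k : normc (m k) * expR (k%:~R * s) = normc (fourier s (D \o @cexp R) k).
  rewrite /fourier (_ : cmean s _ = (expR (k%:~R * s))%:C * m k).
    by rewrite normcM normc_real ger0_norm ?expR_ge0 // mulrC.
  rewrite /m -cmeanZ //; apply: eq_cmean => z _.
  by rewrite expn_lineE mulrNz mulNr opprK /=; ring.
(* The negative coefficients of f vanish, so [cE] gives m (-1 - n) = a^n m (-1). After normalisation
   on the line Re z = s, these infinitely many Fourier coefficients have equal modulus, and Bessel
   forces it to be 0. *)
have m1 : m (- 1) = 0.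
  have mS (n : nat) : m (- 1 - n%:Z) = a ^+ n * m (- 1).
    elim: n => [|n IH]; first by rewrite subr0 expr0 mul1r.
    have := cE (Negz n); rewrite laurent_neg mulr0 add0r => /eqP.
    rewrite eq_sym subr_eq0 => /eqP E.
    rewrite exprS -mulrA -IH (_ : - 1 - n.+1%:Z = Negz n - 1); last first.
      by rewrite NegzE addrC.
    by rewrite E; congr (_ * m _); rewrite NegzE intS opprD.
  have mC (n : nat) : normc (fourier s (D \o @cexp R) (- 1 - n%:Z)) =
      normc (m (- 1)) * expR (- s).
    rewrite -mF mS normcM normcX as_ -expRM_natl -mulrA mulrC -mulrA -expRD.
    by congr (_ * expR _); rewrite intrD mulrNz -[n%:~R]/(n%:R); ring.
  have [B hB] := bD.
  apply/eqP; rewrite -normc_eq0; apply/negPn/negP => mn0.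
  pose c := (normc (m (- 1)) * expR (- s)) ^+ 2.
  have c0 : 0 < c.
    by rewrite exprn_gt0 // mulr_gt0 ?expR_gt0 // lt_neqAle eq_sym mn0 normc_ge0.
  have H n : c *+ n <= B ^+ 2.
    have := @bessel_bound _ s (D \o @cexp R) B
       (map (fun i : nat => - 1 - i%:Z) (iota 0 n)) _ hB.
    rewrite big_map map_inj_uniq ?iota_uniq; last first.
      by move=> i j /addrI/oppr_inj[].
    move=> /(_ isT); apply: le_trans.
    under eq_bigr do rewrite mC.
    by rewrite big_const_seq count_predT size_iota iter_addr_0.
  have := H (Num.bound (B ^+ 2 / c)); apply/negP; rewrite -ltNge.
  by rewrite -mulr_natl -ltr_pdivrMr // archi_boundP // divr_ge0 ?sqr_ge0.
(* The telescoped sum; its remainder has modulus |a| times that of the n-th Fourier coefficient of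
   D, which tends to 0. *)
have S n : \sum_(0 <= k < n.+1) laurent k%:Z * a ^+ k = f a - m n%:Z * a ^+ n.+1.
  elim: n => [|n IH].
    by rewrite big_nat1 cE eqxx sub0r m1 expr0 expr1 -[true%:R]/(1 : R[i]); ring.
  rewrite big_nat_recr //= IH cE -[n.+1%:Z == 0]/false mulr0 add0r.
  rewrite (_ : n.+1%:Z - 1 = n%:Z); last by rewrite intS addrC addKr.
  by rewrite [in RHS]exprS; ring.
have [N HN] := fourier_cvg0 bD e0; exists N.+1 => -[//|n]; rewrite ltnS => /HN.
rewrite S addrC addKr normcN normcM normcX as_ exprSr mulrA -expRM_natl.
rewrite -[n%:R]/(n%:Z%:~R) (mF n%:Z) => /le_trans H.
by apply: le_trans _ (H _ (lexx _)); rewrite ler_piMr ?normc_ge0 // expR_le1 ltW.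
Qed.

End LaurentCoefficients.

(** * Power series on the unit disk and their termwise derivatives *)

Section PowerSeries.
Variable R : realType.
Implicit Types (c : nat -> R[i]) (z h : R[i]) (r : R).

(** Radius of convergence at least 1, in the form that Cauchy's estimate delivers. *)
Definition disk_coef c : Prop := forall r, 0 < r < 1 ->
  exists M : R, forall n, normc (c n) * r ^+ n <= M.

Definition psum c n z : R[i] := \sum_(0 <= k < n) c k * z ^+ k.

Definition pser c z : R[i] := ulim (fun n => psum c n z).

Definition dcoef c : nat -> R[i] := fun n => n.+1%:R * c n.+1.

Lemma sum_geometric_le (q : R) m n : 0 <= q < 1 -> (m <= n)%N ->
  \sum_(m <= k < n) q ^+ k <= q ^+ m / (1 - q).
Proof.
move=> /andP[q0 q1] mn; have q10 : 0 < 1 - q by rewrite subr_gt0.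
rewrite ler_pdivlMr //.
have -> : (\sum_(m <= k < n) q ^+ k) * (1 - q) = q ^+ m - q ^+ n.
  elim: n mn => [|n IH]; first by rewrite leqn0 => /eqP ->; rewrite big_nil subrr mul0r.
  rewrite leq_eqVlt => /predU1P[->|]; first by rewrite big_geq // mul0r subrr.
  rewrite ltnS => mn; rewrite big_nat_recr //= mulrDl IH // exprS; ring.
by rewrite lerBlDr lerDl exprn_ge0.
Qed.

(** Each of the n terms q^k with k < n is at least q^n, and their sum is at most 1 / (1 - q). *)
Lemma natM_geometric_le (q : R) n : 0 <= q < 1 -> n%:R * q ^+ n <= (1 - q)^-1.
Proof.
move=> /andP[q0 q1]; have := @sum_geometric_le q 0 n; rewrite q0 q1 => /(_ isT isT).
rewrite expr0 div1r; apply: le_trans.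
rewrite -[n in n%:R * _](subn0 n) mulr_natl -sumr_const_nat.
rewrite big_nat_cond [leRHS]big_nat_cond; apply: ler_sum => k /andP[/andP[_ kn] _].
by apply: ler_wiXn2l; [|exact: ltW|exact: ltnW].
Qed.

(** Passing from r to the midpoint t of r and 1 gains a factor (r / t)^n, which absorbs a factor
    n. *)
Lemma disk_coef_scale_nat c (u : nat -> nat) : (forall n, (u n <= n)%N) ->
  disk_coef c -> disk_coef (fun n => (u n)%:R * c n).
Proof.
move=> un cM r /andP[r0 r1]; pose t := (r + 1) / 2.
have [rt t1] : r < t /\ t < 1 by rewrite /t; split; lra.
have t0 : 0 < t by exact: lt_trans rt.
have [|M cn] := cM t; first by rewrite t0 t1.
have q01 : 0 <= r / t < 1 by rewrite divr_ge0 ?ltW //= ltr_pdivrMr // mul1r.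
exists ((1 - r / t)^-1 * M) => n; rewrite normcM normc_nat.
have -> : (u n)%:R * normc (c n) * r ^+ n =
    ((u n)%:R * (r / t) ^+ n) * (normc (c n) * t ^+ n).
  by rewrite expr_div_n; field; rewrite expf_neq0 // gt_eqF.
have /andP[q0 _] := q01; have qn : 0 <= (r / t) ^+ n by exact: exprn_ge0.
apply: ler_pM; [exact: mulr_ge0| |  |exact: cn].
  by rewrite mulr_ge0 ?normc_ge0 // exprn_ge0 // ltW.
apply: le_trans (natM_geometric_le n q01).
by rewrite ler_wpM2r // ler_nat.
Qed.

Lemma disk_coefS c : disk_coef (fun n => c n.+1) <-> disk_coef c.
Proof.
split=> cM r r01; have /andP[r0 r1] := r01; have [M cn] := cM r r01.
  exists (normc (c 0%N) + M) => -[|n].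
    rewrite expr0 mulr1 lerDl; apply: le_trans (cn 0%N).
    by rewrite expr0 mulr1 normc_ge0.
  rewrite exprSr mulrA; apply: (@le_trans _ _ M); last by rewrite lerDr normc_ge0.
  apply: le_trans (cn n); rewrite ler_piMr ?(ltW r1) // mulr_ge0 ?normc_ge0 //.
  by rewrite exprn_ge0 // ltW.
exists (M / r) => n; rewrite ler_pdivlMr // -mulrA -exprSr; exact: cn.
Qed.

Lemma disk_coef_dcoef c : disk_coef c -> disk_coef (dcoef c).
Proof.
move=> cM; apply/(disk_coefS (fun n => n%:R * c n)).
exact: (disk_coef_scale_nat (u := id)).
Qed.

Lemma psum_tail c z : disk_coef c -> unit_disk z ->
  exists q M : R, [/\ 0 <= q < 1, 0 <= M & forall m n, (m <= n)%N ->
    normc (psum c n z - psum c m z) <= M * q ^+ m].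
Proof.
move=> cM /unit_diskE z1; pose t := (normc z + 1) / 2.
have z0 := normc_ge0 z.
have [zt t1] : normc z < t /\ t < 1 by rewrite /t; split; lra.
have t0 : 0 < t by exact: le_lt_trans zt.
have [|M cn] := cM t; first by rewrite t0 t1.
have q01 : 0 <= normc z / t < 1.
  by rewrite divr_ge0 ?(ltW t0) //= ltr_pdivrMr // mul1r.
have M0 : 0 <= M by apply: le_trans (cn 0%N); rewrite mulr_ge0 ?normc_ge0 // exprn_ge0 // ltW.
have /andP[q0 q1] := q01.
exists (normc z / t), (M / (1 - normc z / t)); split => //.
  by rewrite divr_ge0 // subr_ge0 ltW.
move=> m n mn.
have -> : psum c n z - psum c m z = \sum_(m <= k < n) c k * z ^+ k.
  by rewrite /psum (big_cat_nat (leq0n m) mn) /=; ring.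
rewrite mulrAC -mulrA.
apply: le_trans (ler_wpM2l M0 (sum_geometric_le q01 mn)).
rewrite mulr_sumr; elim/big_ind2 : _ => [|x x' y y' xx' yy'|k _].
- by rewrite normc0.
- by rewrite (le_trans (ler_normcD _ _)) // lerD.
rewrite normcM normcX; have -> : normc (c k) * normc z ^+ k =
    normc (c k) * t ^+ k * (normc z / t) ^+ k.
  rewrite [(normc z / t) ^+ k]expr_div_n -mulrA [t ^+ k * _]mulrC divfK //.
  by rewrite expf_neq0 // gt_eqF.
by rewrite ler_wpM2r // exprn_ge0.
Qed.

Lemma expn_cvg0 (q M e : R) : 0 <= q < 1 -> 0 <= M -> 0 < e ->
  exists N, forall n, (N <= n)%N -> M * q ^+ n <= e.
Proof.
move=> /andP[q0 q1] M0 e0; have q10 : 0 < 1 - q by rewrite subr_gt0.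
pose N := Num.bound (M / (1 - q) / e); exists N => n Nn.
have n0 : 0 < n%:R :> R.
  apply: lt_le_trans (_ : N%:R <= _); last by rewrite ler_nat.
  by apply: le_lt_trans (archi_boundP _); rewrite !divr_ge0 // ltW.
have := @natM_geometric_le q n; rewrite q0 q1 => /(_ isT) H.
rewrite -(ler_pM2l n0) mulrCA; apply: le_trans (ler_wpM2l M0 H) _.
rewrite -ler_pdivrMr //.
apply: (@le_trans _ _ N%:R); last by rewrite ler_nat.
by apply/ltW/archi_boundP; rewrite !divr_ge0 // ltW.
Qed.

Lemma ev_bounded_psum c z : disk_coef c -> unit_disk z ->
  ev_bounded (fun n => psum c n z).
Proof.
move=> cM zD; have [q [M [q01 M0 H]]] := psum_tail cM zD.
exists (M * q ^+ 0), 0%N => n /H; by rewrite {2}/psum big_geq // subr0.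
Qed.

Lemma psum_cvg c z : disk_coef c -> unit_disk z -> forall e : R, 0 < e ->
  exists N, forall n, (N <= n)%N -> normc (psum c n z - pser c z) <= e.
Proof.
move=> cM zD e e0; have [q [M [q01 M0 H]]] := psum_tail cM zD.
have [N HN] := expn_cvg0 q01 M0 e0; exists N => n /HN; apply: le_trans.
rewrite normcB /pser -{1}(ulim_cst (psum c n z)) -ulimB; last 2 first.
- exact: ev_bounded_psum.
- exact: ev_bounded_cst.
by apply: ulim_le; exists n => k /H.
Qed.

Lemma ulim_psumS c z : disk_coef c -> unit_disk z ->
  ulim (fun n => psum c n.+1 z) = pser c z.
Proof.
move=> cM zD; apply: cvg_ulim => e /(psum_cvg cM zD)[N H].
by exists N => n Nn; apply: H; rewrite leqW.
Qed.

Lemma ev_bounded_psumS c z : disk_coef c -> unit_disk z ->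
  ev_bounded (fun n => psum c n.+1 z).
Proof.
move=> cM /(ev_bounded_psum cM) [M [N H]].
by exists M, N => n Nn; apply: H; rewrite leqW.
Qed.

Lemma pser0 c : pser c 0 = c 0%N.
Proof.
apply: cvg_ulim => e e0; exists 1%N => -[//|n] _.
rewrite /psum big_nat_recl // expr0 mulr1 big1 ?addr0 ?subrr ?normc0 ?ltW //.
by move=> k _; rewrite expr0n mulr0.
Qed.

Lemma pserS c z : disk_coef c -> unit_disk z ->
  pser c z = c 0%N + z * pser (fun n => c n.+1) z.
Proof.
move=> cM zD; have cM' := (disk_coefS c).2 cM.
rewrite -(ulim_psumS cM zD) -(ulim_cst (c 0%N)) /pser -ulimZ; last exact: ev_bounded_psum.
rewrite -ulimD; last 2 first.
- exact: ev_bounded_cst.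
- exact/ev_boundedZ/ev_bounded_psum.
apply: eq_ulim => n; rewrite /psum big_nat_recl // expr0 mulr1; congr (_ + _).
by rewrite mulr_sumr; apply: eq_bigr => k _; rewrite exprS mulrCA.
Qed.

(** With P n the remainder, P (n + 1) = (z + h) P n + n z^(n-1) h^2, and n^2 + n <= (n + 1)^2. The
    factor r^2 on the left avoids an exponent n - 2. *)
Lemma expn_remainder r z h n : 0 < r -> normc z <= r -> normc (z + h) <= r ->
  r ^+ 2 * normc ((z + h) ^+ n - z ^+ n - n%:R * z ^+ n.-1 * h) <=
  normc h ^+ 2 * (n%:R ^+ 2 * r ^+ n).
Proof.
move=> r0 zr zhr; elim: n => [|n IH].
  by rewrite !expr0 subrr mul0r mul0r subr0 normc0 mulr0 expr0n /= mul0r mulr0.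
set P := _ - _ - _ in IH.
have -> : (z + h) ^+ n.+1 - z ^+ n.+1 - n.+1%:R * z ^+ n.+1.-1 * h =
    (z + h) * P + n%:R * z ^+ n.-1 * h ^+ 2.
  rewrite /P /=; case: n {IH P} => [|n] /=; first by rewrite !expr0 !expr1 mul0r mul0r mul0r; ring.
  by rewrite -[n.+2%:R]natr1 !exprS; ring.
have h2 : 0 <= normc h ^+ 2 by rewrite exprn_ge0 // normc_ge0.
have H1 : r ^+ 2 * normc ((z + h) * P) <= r * (normc h ^+ 2 * (n%:R ^+ 2 * r ^+ n)).
  rewrite normcM mulrCA ler_pM ?normc_ge0 // mulr_ge0 ?normc_ge0 //.
  by rewrite exprn_ge0 // ltW.
have H2 : r ^+ 2 * normc (n%:R * z ^+ n.-1 * h ^+ 2) <= n%:R * r ^+ n.+1 * normc h ^+ 2.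
  rewrite normcM [normc (h ^+ 2)]normcX normcM normcX normc_nat mulrA ler_wpM2r //.
  case: n {IH P H1} => [|n]; first by rewrite !mul0r mulr0.
  rewrite mulrCA ler_wpM2l ?ler0n //= (exprD r 2 n) ler_wpM2l ?exprn_ge0 ?(ltW r0) //.
  by rewrite lerXn2r ?nnegrE ?normc_ge0 ?(ltW r0).
apply: (@le_trans _ _ (r ^+ 2 * (normc ((z + h) * P) + normc (n%:R * z ^+ n.-1 * h ^+ 2)))).
  by rewrite ler_wpM2l ?ler_normcD // exprn_ge0 // ltW.
rewrite mulrDr (le_trans (lerD H1 H2)) //.
rewrite -natr1; have : 0 <= normc h ^+ 2 * ((n%:R + 1) * r ^+ n.+1).
  by apply: mulr_ge0 => //; apply: mulr_ge0; [exact: addr_ge0|exact/exprn_ge0/ltW].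
rewrite [r ^+ n.+1]exprS; lra.
Qed.

(** Summing [expn_remainder] bounds the error of the linear approximation by |h|^2 B / r^2, where B
    bounds the sums of |c k| k^2 r^k. *)
Lemma pser_cderiv c z : disk_coef c -> unit_disk z ->
  cderiv (pser c) z (pser (dcoef c) z).
Proof.
move=> cM zD; have /unit_diskE z1 := zD; pose r := (normc z + 1) / 2.
have z0 := normc_ge0 z.
have [zr r1] : normc z < r /\ r < 1 by rewrite /r; split; lra.
have r0 : 0 < r by exact: le_lt_trans zr.
have dM := disk_coef_dcoef cM.
pose c2 n : R[i] := n%:R * (n%:R * c n).
have c2M : disk_coef c2.
  by apply: (disk_coef_scale_nat (u := id)) => //; exact: (disk_coef_scale_nat (u := id)).
pose rz : R[i] := r%:C.
have rD : unit_disk rz by rewrite unit_diskE normc_real ger0_norm // ltW.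
(* The moduli of k^2 c k, taken at the real point r: [psum_tail] for this series yields B. *)
pose c3 n : R[i] := (normc (c2 n))%:C.
have c3M : disk_coef c3.
  move=> t /c2M[M H]; exists M => n; rewrite normc_real ger0_norm ?normc_ge0 //.
have [q [B [/andP[q0 q1] B0 HB]]] := psum_tail c3M rD.
have sumB n : \sum_(0 <= k < n) normc (c k) * (k%:R ^+ 2 * r ^+ k) <= B.
  have := HB 0%N n (leq0n n); rewrite {2}/psum big_geq // subr0 expr0 mulr1.
  apply: le_trans; apply: le_trans (Re_le_normc _).
  rewrite /psum (_ : (\sum_(0 <= k < n) _ : R[i]) =
    (\sum_(0 <= k < n) normc (c k) * (k%:R ^+ 2 * r ^+ k))%:C) //.
  rewrite rmorph_sum /=; apply: eq_bigr => k _.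
  rewrite /c3 /c2 !normcM normc_nat /rz -rmorphXn -rmorphM; congr (_%:C); ring.
move=> e e0; have r20 : 0 < r ^+ 2 by rewrite exprn_gt0.
have B1 : 0 < B + 1 by rewrite ltr_wpDl.
exists (Num.min (r - normc z) (e * r ^+ 2 / (B + 1))).
  by rewrite lt_min subr_gt0 zr divr_gt0 // mulr_gt0.
move=> h; rewrite lt_min => /andP[hr he].
have zhr : normc (z + h) <= r by have := ler_normcD z h; lra.
have zhD : unit_disk (z + h) by apply/unit_diskE; exact: le_lt_trans r1.
have b1 := ev_bounded_psumS cM zhD; have b2 := ev_bounded_psumS cM zD.
have b3 := ev_boundedZ (- h) (ev_bounded_psum dM zD).
have b4 := ev_boundedD b1 (ev_boundedZ (- 1) b2).
(* Partial sums with n + 1 terms are paired with n terms of the derived series, so that each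
   polynomial meets its own derivative. *)
have -> : pser c (z + h) - pser c z - pser (dcoef c) z * h =
  ulim (fun n => psum c n.+1 (z + h) + - 1 * psum c n.+1 z +
                 - h * psum (dcoef c) n z).
  rewrite (ulimD b4 b3) (ulimD b1 (ev_boundedZ (- 1) b2)) !ulimZ //; last exact: ev_bounded_psum.
  by rewrite !ulim_psumS // -/(pser (dcoef c) z); ring.
have [->|h0] := eqVneq h 0.
  rewrite normc0 mulr0; apply: ulim_le; exists 0%N => n _.
  rewrite addr0 oppr0 mul0r addr0 mulN1r subrr normc0 //.
apply: (@le_trans _ _ (normc h ^+ 2 * (B / r ^+ 2))).
  apply: ulim_le; exists 0%N => n _.
  rewrite mulrA ler_pdivlMr // mulrC.
  have -> : psum c n.+1 (z + h) + - 1 * psum c n.+1 z + - h * psum (dcoef c) n z =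
      \sum_(0 <= k < n.+1) c k * ((z + h) ^+ k - z ^+ k - k%:R * z ^+ k.-1 * h).
    have -> : - h * psum (dcoef c) n z =
        \sum_(0 <= k < n.+1) - (c k * (k%:R * z ^+ k.-1 * h)).
      rewrite big_nat_recl // !mul0r mulr0 oppr0 add0r /psum mulr_sumr.
      by apply: eq_bigr => k _; rewrite /dcoef /=; ring.
    rewrite /psum mulr_sumr -!big_split /=; apply: eq_bigr => k _; ring.
  apply: le_trans (ler_wpM2l (exprn_ge0 2 (normc_ge0 h)) (sumB n.+1)).
  rewrite mulr_sumr.
  apply: (@le_trans _ _ (\sum_(0 <= k < n.+1) r ^+ 2 *
     normc (c k * ((z + h) ^+ k - z ^+ k - k%:R * z ^+ k.-1 * h)))).
    rewrite -mulr_sumr ler_wpM2l ?(ltW r20) //.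
    elim/big_ind2 : _ => [|x x' y y' xx' yy'|//]; first by rewrite normc0.
    by rewrite (le_trans (ler_normcD _ _)) // lerD.
  apply: ler_sum => k _; rewrite normcM mulrCA [leRHS]mulrCA.
  by rewrite ler_wpM2l ?normc_ge0 // expn_remainder // ltW.
rewrite expr2 -mulrA mulrC ler_wpM2r ?normc_ge0 //.
rewrite mulrA ler_pdivrMr // mulrC.
apply: le_trans (_ : (B + 1) * normc h <= _).
  by rewrite ler_wpM2r ?normc_ge0 // lerDl.
by rewrite mulrC -ler_pdivlMr // ltW.
Qed.

End PowerSeries.

(** * Taylor coefficients as circle means *)

Section TaylorCoefficients.
Variable R : realType.
Implicit Types (f g w : R[i] -> R[i]) (c : nat -> R[i]) (z h : R[i]).

Lemma unit_disk_nbhs z : unit_disk z ->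
  exists2 d : R, 0 < d & forall h, normc h < d -> unit_disk (z + h).
Proof.
move=> /unit_diskE z1; exists (1 - normc z); first by rewrite subr_gt0.
move=> h hd; apply/unit_diskE; apply: le_lt_trans (ler_normcD _ _) _; lra.
Qed.

Lemma cderiv_ext_disk f g z l : unit_disk z ->
  (forall v, unit_disk v -> f v = g v) -> cderiv f z l -> cderiv g z l.
Proof.
move=> zD fg; have [d d0 H] := unit_disk_nbhs zD.
by apply: (cderiv_ext d0) => h /H /fg.
Qed.

Lemma laurent_disk_coef f : analytic_on_disk f ->
  disk_coef (fun n => laurent f n%:Z).
Proof.
move=> fA r /andP[r0 r1]; have s0 : ln r < 0 by rewrite ln_lt0 // r0.
have [M fM] := seg_bounded_analytic fA s0; exists M => n.
have := laurent_le fA n%:Z s0 fM.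
by rewrite -[n%:~R]/(n%:R) expRM_natl lnK.
Qed.

Lemma analytic_pser f z : analytic_on_disk f -> unit_disk z ->
  f z = pser (fun n => laurent f n%:Z) z.
Proof. by move=> fA zD; apply/esym/cvg_ulim => e; exact: taylor_cvg. Qed.

Lemma disk_coef_iter c n : disk_coef c -> disk_coef (iter n (@dcoef R) c).
Proof. by move=> cD; elim: n => //= n; exact: disk_coef_dcoef. Qed.

Lemma iter_dcoef c n k :
  k`!%:R * iter n (@dcoef R) c k = (n + k)`!%:R * c (n + k)%N.
Proof.
elim: n k => [|n IH] k //=.
by rewrite /dcoef mulrA -natrM mulnC -factS IH addnS addSn.
Qed.

Lemma derive1n_pser f c n z : disk_coef c ->
  (forall v, unit_disk v -> f v = pser c v) -> unit_disk z ->
  derive1n n f z = pser (iter n (@dcoef R) c) z.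
Proof.
move=> cD fc; elim: n z => [|n IH] z zD; first exact: fc.
rewrite derive1nS; apply: derive1_cderiv.
apply: (@cderiv_ext_disk (pser (iter n (@dcoef R) c))) => //.
  by move=> v vD; rewrite IH.
by apply: pser_cderiv => //; exact: disk_coef_iter.
Qed.

Lemma unit_disk0 : unit_disk (0 : R[i]).
Proof. by rewrite unit_diskE normc0 ltr01. Qed.

Lemma taylor_coef_pser f c n : disk_coef c ->
  (forall v, unit_disk v -> f v = pser c v) -> taylor_coef f n = c n.
Proof.
move=> cD fc; rewrite /taylor_coef (derive1n_pser n cD fc unit_disk0) pser0.
have := iter_dcoef c n 0; rewrite fact0 mul1r addn0 => ->.
by rewrite mulrC mulKf // pnatr_eq0 -lt0n fact_gt0.
Qed.

(** Makes Cauchy's estimate and Bessel's inequality available for coefficients defined by iterated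
    derivatives. *)
Lemma taylor_coef_laurent f n : analytic_on_disk f ->
  taylor_coef f n = laurent f n%:Z.
Proof.
move=> fA; apply: (taylor_coef_pser _ (laurent_disk_coef fA)) => v.
exact: analytic_pser.
Qed.

Lemma taylor_disk_coef f : analytic_on_disk f -> disk_coef (taylor_coef f).
Proof.
move=> fA r /(laurent_disk_coef fA)[M H]; exists M => n.
by rewrite taylor_coef_laurent.
Qed.

Lemma taylor_pser f z : analytic_on_disk f -> unit_disk z ->
  f z = pser (taylor_coef f) z.
Proof.
move=> fA zD; rewrite {1}(analytic_pser fA zD); congr (pser _ z).
by apply/funext => n; rewrite taylor_coef_laurent.
Qed.

End TaylorCoefficients.

(** * Coefficients of Schwarz functions *)

Section SchwarzCoefficients.
Variable R : realType.
Variable w : R[i] -> R[i].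
Hypothesis w_analytic : analytic_on_disk w.
Hypothesis w_disk : forall z, unit_disk z -> unit_disk (w z).
Hypothesis w0 : w 0 = 0.

(* Bessel for w(z)(1 + y z) on |z| = e^s, compared with 1 + y z. *)
Lemma schwarz_bessel (y : R[i]) (s : R) : s < 0 ->
  expR s ^+ 2 * normc (taylor_coef w 1) ^+ 2 +
  (expR s ^+ 2) ^+ 2 * normc (taylor_coef w 2 + y * taylor_coef w 1) ^+ 2 <=
  1 + normc y ^+ 2 * expR s ^+ 2.
Proof.
move=> s0; pose p z := 1 + y * @cexp R z; pose h z := w (cexp z) * p z.
have bw := seg_bounded_analytic w_analytic s0.
have be := seg_bounded_cexpz s (1 : int).
have bp : seg_bounded s p.
  have [M HM] := seg_boundedD (seg_bounded_cst s 1) (seg_boundedZ y be).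
  by exists M => z /HM; rewrite cexpz1.
have bh : seg_bounded s h by exact: seg_boundedM.
have L k : fourier s h k = (expR (k%:~R * s))%:C * (laurent w k + y * laurent w (k - 1)).
  have bk j : seg_bounded s (fun z => w (cexp z) * cexpz (- j) z).
    exact/seg_boundedM/seg_bounded_cexpz.
  rewrite -(laurentE w_analytic k s0) -(laurentE w_analytic (k - 1) s0).
  rewrite -(cmeanZ y (bk _)) -(cmeanD (bk _) (seg_boundedZ y (bk _))).
  rewrite -cmeanZ; last exact/seg_boundedD/seg_boundedZ.
  apply: eq_cmean => z _.
  rewrite expn_lineE opprB addrC cexpzD cexpz1 /h /p mulrNz mulNr opprK.
  ring.
have := @bessel _ s h [:: 1; 2] bh isT.
(* Only the indices 1 and 2 are kept; at index 1 the multiple of y is the constant term of w, which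
   is 0. *)
rewrite !big_cons big_nil addr0 !L subrr laurent0 // w0 mulr0 addr0.
rewrite (_ : 2 - 1 = 1) // mul1r -![laurent w _]taylor_coef_laurent //.
rewrite !normcM !normc_real !ger0_norm ?expR_ge0 // !exprMn.
rewrite (_ : 2%:~R = 2%:R :> R) // expRM_natl => /le_trans; apply.
have bpp : seg_bounded s (fun z => p z * conjc (p z)).
  exact/seg_boundedM/seg_bounded_conj.
have bhh : seg_bounded s (fun z => h z * conjc (h z)).
  exact/seg_boundedM/seg_bounded_conj.
(* The cross terms of |1 + y exp z|^2 have mean 0. *)
have pE : cmean s (fun z => p z * conjc (p z)) =
    (1 + normc y ^+ 2 * expR s ^+ 2)%:C.
  have by1 := seg_boundedZ y be; have by2 := seg_bounded_conj by1.
  have bc := seg_bounded_cst s ((1 + normc y ^+ 2 * expR s ^+ 2)%:C).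
  have E : cmean s (cexpz 1) = 0 by rewrite cmean_cexpz.
  transitivity (cmean s (fun z => (1 + normc y ^+ 2 * expR s ^+ 2)%:C +
      y * cexpz 1 z + conjc (y * cexpz 1 z : R[i]))); last first.
    rewrite (cmeanD (seg_boundedD bc by1) by2) (cmeanD bc by1) cmean_cst.
    by rewrite (cmean_conj by1) (cmeanZ y be) E mulr0 conjc0 !addr0.
  apply: eq_cmean => z [zs _]; rewrite /p cexpz1.
  have -> : conjc (1 + y * cexp z) = 1 + conjc (y * cexp z).
    by rewrite [LHS]rmorphD rmorph1.
  rewrite -exprMn -zs -normc_cexp -normcM.
  have -> : (1 + normc (y * cexp z) ^+ 2)%:C = 1 + (normc (y * cexp z) ^+ 2)%:C :> R[i].
    by rewrite [LHS]rmorphD rmorph1.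
  rewrite -mulcJ.
  ring.
have : 0 <= cmean s (fun z => p z * conjc (p z) - h z * conjc (h z)).
  apply: cmean_ge0.
    have [M HM] := bpp; have [N HN] := bhh; exists (M + N) => z sz.
    by rewrite (le_trans (ler_normcB _ _)) // lerD ?HM ?HN.
  move=> z [zs _]; rewrite !mulcJ -rmorphB ler0c subr_ge0.
  rewrite lerXn2r ?nnegrE ?normc_ge0 // /h normcM ler_piMl ?normc_ge0 // ltW //.
  by apply/unit_diskE/w_disk/unit_disk_cexp; rewrite zs.
rewrite cmeanB // pE lecE => /andP[_]; set X := cmean s _.
by rewrite cReD (_ : complex.Re (- X) = - complex.Re X) ?subr_ge0 //; case: X.
Qed.

(** The case of radius 1 in [schwarz_bessel], obtained from radii 1 - e by contradiction. *)
Lemma schwarz_contraction (y : R[i]) :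
  normc (taylor_coef w 1) ^+ 2 + normc (taylor_coef w 2 + y * taylor_coef w 1) ^+ 2 <=
  1 + normc y ^+ 2.
Proof.
set A := normc _ ^+ 2; set B := normc _ ^+ 2; set Y := 1 + _.
have A0 : 0 <= A by rewrite exprn_ge0 ?normc_ge0.
have B0 : 0 <= B by rewrite exprn_ge0 ?normc_ge0.
have Y1 : 1 <= Y by rewrite lerDl exprn_ge0 ?normc_ge0.
rewrite leNgt; apply/negP => YAB.
have AB0 : 0 < A + B by lra.
(* Since (1 - e)^4 >= 1 - 4 e, the inequality at radius 1 - e gives (1 - 4 e) (A + B) <= Y. This e
   makes the loss half of the supposed excess A + B - Y, which contradicts its positivity. *)
pose e := (A + B - Y) / (8 * (A + B)).
have e0 : 0 < e by rewrite divr_gt0 ?mulr_gt0 // subr_gt0.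
have eE : e * (8 * (A + B)) = A + B - Y.
  by rewrite divfK // mulf_neq0 // ?pnatr_eq0 // gt_eqF.
have e1 : e < 1 by rewrite ltr_pdivrMr ?mulr_gt0 //; lra.
have r0 : 0 < 1 - e by lra.
have s0 : ln (1 - e) < 0 by rewrite ln_lt0 // r0 /=; lra.
have := schwarz_bessel y s0; rewrite lnK ?posrE // -/A -/B.
set r2 := (1 - e) ^+ 2 => H.
have r21 : r2 <= 1 by rewrite /r2 expr2; nra.
have r2e : 1 - 2 * e <= r2 by rewrite /r2 expr2; nra.
have r20 : 0 <= r2 by rewrite exprn_ge0 // ltW.
have r4e : 1 - 4 * e <= r2 ^+ 2.
  by rewrite expr2; nra.
have r42 : r2 ^+ 2 <= r2 by rewrite expr2 ler_piMl.
have H1 : r2 ^+ 2 * (A + B) <= Y.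
  rewrite mulrDr; apply: le_trans (_ : r2 * A + r2 ^+ 2 * B <= _).
    by rewrite lerD2r ler_wpM2r.
  apply: le_trans H _; rewrite lerD2l ler_piMr // exprn_ge0 ?normc_ge0 //.
have : (1 - 4 * e) * (A + B) <= r2 ^+ 2 * (A + B) by rewrite ler_wpM2r // ltW.
lra.
Qed.

Lemma schwarz_coef : normc (taylor_coef w 2) <= 1 - normc (taylor_coef w 1) ^+ 2.
Proof.
move: (taylor_coef w 1) (taylor_coef w 2) schwarz_contraction => c1 c2 K.
set a := normc c1 ^+ 2.
have c20 := normc_ge0 c2.
have := K 0; rewrite mul0r addr0 normc0 expr0n addr0 -/a.
move=> H0; have a1 : a <= 1 by have := sqr_ge0 (normc c2); lra.
(* If |c1| = 1, the inequality for y = 0 already gives c2 = 0; otherwise 1 - a is invertible. *)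
have [a1'|a1'] := eqVneq a 1.
  have : normc c2 ^+ 2 <= 0 by lra.
  by rewrite a1' subrr exprn_even_le0 //= => /eqP ->.
have a10 : 0 < 1 - a by rewrite subr_gt0 lt_neqAle a1' a1.
pose t : R := (1 - a)^-1; have t0 : 0 < t by rewrite invr_gt0.
have ta : t * (1 - a) = 1 by rewrite mulVf // gt_eqF.
(* This y = c2 conj(c1) / (1 - a) maximises |c2 + y c1|^2 - |y|^2, and c2 + y c1 becomes c2 / (1 -
   a). *)
have := K (t%:C * (c2 * conjc c1)); rewrite -/a.
have -> : c2 + t%:C * (c2 * conjc c1) * c1 = c2 * t%:C.
  have -> : c2 + t%:C * (c2 * conjc c1) * c1 = c2 * (1 + t%:C * (c1 * conjc c1)) by ring.
  rewrite mulcJ -/a -rmorphM -(rmorph1 (real_complex R)) -rmorphD; congr (_ * _%:C).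
  lra.
rewrite !normcM normc_conj normc_real (gtr0_norm t0) !exprMn -/a.
set b := normc c2 ^+ 2 => H.
have b0 : 0 <= b by exact: sqr_ge0.
have : b * t ^+ 2 * (1 - a) <= 1 - a by lra.
rewrite -ler_pdivlMr // divff ?gt_eqF // => H1.
rewrite -(ler_pXn2r (n := 2)) ?nnegrE ?(ltW a10) // -/b.
apply: le_trans (_ : b * t ^+ 2 * (1 - a) ^+ 2 <= _).
  by rewrite -mulrA -exprMn ta expr1n mulr1.
by rewrite ler_piMl ?exprn_ge0 ?(ltW a10).
Qed.

End SchwarzCoefficients.

(** * Coefficients of starlike functions *)

Section SecondOrder.
Variable R : realType.
Implicit Types (f g w phi F G : R[i] -> R[i]) (c : nat -> R[i]) (z : R[i]).

(** The derivatives are carried as explicit functions, so that the product and chain rules yield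
    expressions ready for evaluation at 0. *)
Definition diff2 F F1 F2 : Prop := forall z : R[i], unit_disk z ->
  cderiv F z (F1 z) /\ cderiv F1 z (F2 z).

Lemma diff2_pser c : disk_coef c ->
  diff2 (pser c) (pser (dcoef c)) (pser (dcoef (dcoef c))).
Proof.
by move=> cD z zD; split; apply: pser_cderiv => //; exact: disk_coef_dcoef.
Qed.

Lemma diff2_taylor f : analytic_on_disk f -> diff2 f (pser (dcoef (taylor_coef f)))
  (pser (dcoef (dcoef (taylor_coef f)))).
Proof.
move=> fA z zD; have [H1 H2] := diff2_pser (taylor_disk_coef fA) zD.
split=> //; apply: (cderiv_ext_disk zD _ H1) => v vD.
by rewrite -taylor_pser.
Qed.

Lemma diff2M F F1 F2 G G1 G2 : diff2 F F1 F2 -> diff2 G G1 G2 ->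
  diff2 (fun z => F z * G z) (fun z => F z * G1 z + G z * F1 z)
    (fun z => (F z * G2 z + G1 z * F1 z) + (G z * F2 z + F1 z * G1 z)).
Proof.
move=> HF HG z zD; have [F1z F2z] := HF z zD; have [G1z G2z] := HG z zD.
by split; [exact: cderivM|apply: cderivD; exact: cderivM].
Qed.

Lemma diff2_comp F F1 F2 w w1 w2 : diff2 F F1 F2 -> diff2 w w1 w2 ->
  (forall z, unit_disk z -> unit_disk (w z)) ->
  diff2 (fun z => F (w z)) (fun z => F1 (w z) * w1 z)
    (fun z => F1 (w z) * w2 z + w1 z * (F2 (w z) * w1 z)).
Proof.
move=> HF Hw wD z zD; have [F1z F2z] := HF _ (wD z zD); have [w1z w2z] := Hw z zD.
split; first exact: cderiv_comp.
by apply: cderivM => //; exact: cderiv_comp.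
Qed.

Lemma diff2_unique F F1 F2 G G1 G2 : diff2 F F1 F2 -> diff2 G G1 G2 ->
  (forall z, unit_disk z -> F z = G z) ->
  forall z, unit_disk z -> F1 z = G1 z /\ F2 z = G2 z.
Proof.
move=> HF HG FG.
have E1 z : unit_disk z -> F1 z = G1 z.
  move=> zD; have [F1z _] := HF z zD; have [G1z _] := HG z zD.
  exact: cderiv_unique (cderiv_ext_disk zD FG F1z) G1z.
move=> z zD; split; first exact: E1.
have [_ F2z] := HF z zD; have [_ G2z] := HG z zD.
exact: cderiv_unique (cderiv_ext_disk zD E1 F2z) G2z.
Qed.

(* Two derivatives at 0 of f' = (f / z) (phi o w). *)
Lemma Sstar_coef phi w f : analytic_on_disk phi -> phi 0 = 1 ->
  analytic_on_disk w -> (forall z, unit_disk z -> unit_disk (w z)) -> w 0 = 0 ->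
  class_S f -> (forall z, unit_disk z -> starlike_quotient f z = phi (w z)) ->
  taylor_coef f 2 = taylor_coef phi 1 * taylor_coef w 1 /\
  2 * taylor_coef f 3 = taylor_coef f 2 ^+ 2 +
    (taylor_coef phi 1 * taylor_coef w 2 + taylor_coef phi 2 * taylor_coef w 1 ^+ 2).
Proof.
move=> phiA phi0 wA wD w0 [[fA f0 f1] fU] fq.
have Hphi := diff2_taylor phiA; have Hw := diff2_taylor wA.
have Hf := diff2_taylor fA; have cD := taylor_disk_coef fA.
have fE z := @taylor_pser R f z fA.
move: (taylor_coef phi) (taylor_coef w) (taylor_coef f) => b a c
  in Hphi Hw Hf cD fE f0 f1 *.
(* The coefficients of f / z, which is thereby defined at 0 as well. *)
pose s n := c n.+1; have sD : disk_coef s by apply/disk_coefS.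
have fg z : unit_disk z -> f z = z * pser s z.
  by move=> zD; rewrite fE // pserS // f0 add0r.
have f00 : f 0 = 0 by rewrite fg ?mul0r //; exact: unit_disk0.
have f'E z : unit_disk z -> derive1 f z = pser (dcoef c) z.
  by move=> zD; apply: derive1_cderiv; exact: (Hf z zD).1.
(* Univalence and f 0 = 0 make f nonzero away from 0, so the quotient can be cleared; at 0 both
   sides equal c 1. *)
have E z : unit_disk z -> pser (dcoef c) z = pser s z * phi (w z).
  move=> zD; have [->|z0] := eqVneq z 0.
    by rewrite w0 phi0 !pser0 /dcoef mulr1 mul1r.
  have fz0 : f z != 0.
    by apply: contraNneq z0 => fz; apply/eqP/fU => //; [exact: unit_disk0|rewrite fz].
  apply: (mulfI z0); rewrite -f'E // mulrA -fg // -fq // /starlike_quotient.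
  by rewrite (negPf z0) [RHS]mulrC divfK.
have [] := diff2_unique (diff2_pser (disk_coef_dcoef cD))
  (diff2M (diff2_pser sD) (diff2_comp Hphi Hw wD)) E (unit_disk0 R).
rewrite w0 phi0 !pser0 /dcoef /s f1 => E1 E2.
have c2E : c 2%N = b 1%N * a 1%N.
  apply: (addrI (c 2%N)); transitivity (1 * (2 * c 2%N)); first by ring.
  by rewrite E1; ring.
have n2 : (2 : R[i]) != 0 by rewrite pnatr_eq0.
split=> //; apply: (mulfI n2).
(* The second derivative is 6 c 3 on the left, and f / z contributes 2 c 3 on the right; the
   difference is 4 c 3. *)
transitivity (1 * (2 * (3 * c 3%N)) - 1 * (2 * c 3%N)); first by ring.
by rewrite E2 c2E; ring.
Qed.

End SecondOrder.

(** * Construction of the extremal function *)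

Section NoshiroWarschawski.
Variable R : realType.

(** The half-plane is convex, so the mean value theorem applies along the segment from u to v. *)
Lemma Re_deriv_gt0_inj (F G : R[i] -> R[i]) :
  (forall z : R[i], complex.Re z < 0 -> cderiv F z (G z)) ->
  (forall z : R[i], complex.Re z < 0 -> 0 < complex.Re (G z)) ->
  forall u v : R[i], complex.Re u < 0 -> complex.Re v < 0 -> F u = F v -> u = v.
Proof.
move=> FG G0 u v u0 v0 Fuv; apply/eqP; apply/negPn/negP => uv.
pose d := v - u; have d0 : d != 0 by rewrite subr_eq0 eq_sym.
have nd0 : 0 < normc d by rewrite normc_gt0.
pose x (t : R) := u + t%:C * d.
have x0 (t : R) : 0 <= t <= 1 -> complex.Re (x t) < 0.
  move=> /andP[t0 t1].
  have -> : complex.Re (x t) = (1 - t) * complex.Re u + t * complex.Re v.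
    by rewrite /x /d; case: (u) => a b; case: (v) => a' b' /=; ring.
  move: t0; rewrite le_eqVlt => /predU1P[<-|t0]; first by rewrite subr0 mul1r mul0r addr0.
  have := mulr_ge0_le0 (_ : 0 <= 1 - t) (ltW u0); rewrite subr_ge0 t1 => /(_ isT).
  have : t * complex.Re v < 0 by rewrite pmulr_rlt0.
  lra.
(* Division by the direction d makes Re G itself the derivative in t. *)
pose phi (t : R) := complex.Re ((F (x t) - F u) / d).
have phi' (t : R) : 0 <= t <= 1 -> is_derive t 1 phi (complex.Re (G (x t))).
  move=> /x0 /FG Fx; apply/is_derive_epsdelta => e e0.
  have [r r0 H] := Fx e e0; exists (r / normc d); first by rewrite divr_gt0.
  move=> h; rewrite ltr_pdivlMr // => hr.
  have nh : normc (h%:C * d) = `|h| * normc d by rewrite normcM normc_real.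
  have := H (h%:C * d); rewrite nh => /(_ hr).
  rewrite (_ : x t + h%:C * d = x (t + h)); last by rewrite /x rmorphD; ring.
  rewrite [e * (_ * _)]mulrA -ler_pdivrMr // => {}H; apply: le_trans _ H.
  rewrite -normcV -normcM; apply: le_trans _ (normRe_le_normc _).
  rewrite le_eqVlt; apply/orP; left; apply/eqP; congr `|_|; rewrite /phi.
  have -> : (F (x (t + h)) - F (x t) - G (x t) * (h%:C * d)) / d =
    (F (x (t + h)) - F u) / d - (F (x t) - F u) / d - G (x t) * h%:C by field.
  move: ((F (x (t + h)) - F u) / d) ((F (x t) - F u) / d) (G (x t)).
  by case=> a1 b1 [a2 b2] [a3 b3] /=; ring.
have [| |s s01] := @MVT R phi (fun t => complex.Re (G (x t))) 0 1 ltr01.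
- by move=> t; rewrite in_itv /= => /andP[t0 t1]; apply: phi'; rewrite !ltW.
- apply: derivable_within_continuous => t; rewrite in_itv /= => t01.
  by case: (phi' t t01).
have x1 : x 1 = v by rewrite /x mul1r /d addrC subrK.
have -> : phi 1 = 0 by rewrite /phi x1 Fuv subrr mul0r.
have -> : phi 0 = 0 by rewrite /phi /x mul0r addr0 subrr mul0r.
rewrite !subrr subr0 mulr1 => E; have := G0 (x s).
by rewrite -E ltxx => H; apply/notF/H/x0; move: s01; rewrite in_itv /= => /andP[? ?]; rewrite !ltW.
Qed.

End NoshiroWarschawski.

Section SstarFunction.
Variable R : realType.
Variable p : R[i] -> R[i].
Hypothesis p_analytic : analytic_on_disk p.
Hypothesis p0 : p 0 = 1.
Hypothesis p_Re_gt0 : forall z : R[i], unit_disk z -> 0 < complex.Re (p z).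

Definition log_coef n : R[i] := taylor_coef p n / n%:R.

(* log_series is the primitive of (p z - 1) / z vanishing at 0; at n = 0 the
   coefficient is x / 0 = 0. *)
Definition log_series : R[i] -> R[i] := pser log_coef.

Definition Sstar_fun z : R[i] := z * cexp (log_series z).

Lemma log_disk_coef : disk_coef log_coef.
Proof.
move=> r /andP[r0 r1]; have [|M H] := taylor_disk_coef p_analytic (r := r).
  by rewrite r0 r1.
exists M => n; apply: le_trans (H n); rewrite ler_wpM2r ?exprn_ge0 ?(ltW r0) //.
rewrite /log_coef normcM normcV normc_nat ler_piMr ?normc_ge0 //.
by case: n => [|n]; rewrite ?invr0 // invf_le1 ?ltr0n // ler1n.
Qed.

Lemma log_series0 : log_series 0 = 0.
Proof. by rewrite /log_series pser0 /log_coef invr0 mulr0. Qed.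

Lemma dcoef_log n : dcoef log_coef n = taylor_coef p n.+1.
Proof. by rewrite /dcoef /log_coef mulrC divfK // pnatr_eq0. Qed.

Lemma log_series_cderiv z : unit_disk z ->
  exists2 l, cderiv log_series z l & p z = 1 + z * l.
Proof.
move=> zD; exists (pser (fun n => taylor_coef p n.+1) z).
  rewrite -(funext dcoef_log); apply: pser_cderiv => //; exact: log_disk_coef.
rewrite [LHS]taylor_pser // pserS //; last exact: taylor_disk_coef.
by rewrite -pser0 -taylor_pser ?p0 //; exact: unit_disk0.
Qed.

Lemma Sstar_fun_cderiv z : unit_disk z ->
  cderiv Sstar_fun z (cexp (log_series z) * p z).
Proof.
move=> zD; have [l lz ->] := log_series_cderiv zD.
have := cderivM (cderiv_id z) (cderiv_comp (cderiv_cexp (log_series z)) lz).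
by congr cderiv; ring.
Qed.

Lemma Sstar_fun_quotient z : unit_disk z -> starlike_quotient Sstar_fun z = p z.
Proof.
move=> zD; rewrite /starlike_quotient; have [->|z0] := eqVneq z 0; first by rewrite p0.
rewrite (derive1_cderiv (Sstar_fun_cderiv zD)) /Sstar_fun.
by field; rewrite z0 cexp_neq0.
Qed.

(* In the coordinate z = exp t the function becomes exp (t + log_series z),
   and t |-> t + log_series (exp t) has derivative p, of positive real part. *)
Lemma Sstar_fun_univalent : univalent_on_disk Sstar_fun.
Proof.
pose F t := t + log_series (@cexp R t).
have FD t : complex.Re t < 0 -> cderiv F t (p (cexp t)).
  move=> /unit_disk_cexp tD; have [l lz ->] := log_series_cderiv tD.
  have := cderivD (cderiv_id t) (cderiv_comp lz (cderiv_cexp t)).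
  by congr cderiv; ring.
have F_inj := Re_deriv_gt0_inj FD (fun t t0 => p_Re_gt0 ((unit_disk_cexp t).2 t0)).
have fE t : Sstar_fun (cexp t) = cexp (F t) by rewrite /F cexpD.
have ek (k : int) t : cexp (k%:~R * i2pi R + t) = cexp t by rewrite cexpD cexp_int mul1r.
have Fk (k : int) t : F (k%:~R * i2pi R + t) = k%:~R * i2pi R + F t.
  by rewrite /F ek addrA.
clearbody F.
have f_eq0 z : (Sstar_fun z == 0) = (z == 0).
  by rewrite /Sstar_fun mulf_eq0 (negPf (cexp_neq0 _)) orbF.
move=> z1 z2 z1D z2D fz; have [z10|z10] := eqVneq z1 0.
  apply/esym/eqP; rewrite z10 -f_eq0 -fz z10 f_eq0 //.
have z20 : z2 != 0 by rewrite -f_eq0 -fz f_eq0.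
have [t1 E1] := cexp_onto z10; have [t2 E2] := cexp_onto z20.
move: fz z1D z2D; rewrite {}E1 {}E2 !fE => fz /unit_disk_cexp t1D /unit_disk_cexp t2D.
have : cexp (F t1 - F t2) = 1 by rewrite cexpD fz cexpN divff // cexp_neq0.
(* The two values of F differ by a multiple of 2 pi i, which [Fk] moves into the argument;
   injectivity of F then identifies t1 with a translate of t2, and both have the same
   exponential. *)
move=> /cexp_eq1[k /eqP]; rewrite subr_eq -Fk => /eqP F12.
have Rk : complex.Re (k%:~R * i2pi R + t2) = complex.Re t2.
  rewrite cReD -(rmorph_int (real_complex R)) cReM /=.
  by rewrite mulr0 mul0r subrr add0r.
by rewrite -(ek k t2) (F_inj _ _ t1D _ F12) // Rk.
Qed.

Lemma Sstar_fun_S : class_S Sstar_fun.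
Proof.
split; last exact: Sstar_fun_univalent.
split.
- by move=> z /Sstar_fun_cderiv /cderivP[].
- by rewrite /taylor_coef derive1n0 /Sstar_fun mul0r mul0r.
- rewrite /taylor_coef derive1n1 (derive1_cderiv (Sstar_fun_cderiv (unit_disk0 R))).
  by rewrite log_series0 cexp0 p0 mul1r divr1.
Qed.

End SstarFunction.

(** * The Toeplitz determinant, the bound and its sharpness *)

Section ToeplitzBound.
Variable R : realType.
Implicit Types (f w phi : R[i] -> R[i]).

Lemma toeplitz_det22 f :
  toeplitz_det f 2 2 = taylor_coef f 2 ^+ 2 - taylor_coef f 3 ^+ 2.
Proof.
rewrite /toeplitz_det (expand_det_row _ ord0) !big_ord_recl big_ord0 addr0.
rewrite /cofactor !det_mx11 !mxE /=.
by rewrite /bump /= !addn0 expr0 expr1 mul1r mulN1r mulrN -!expr2.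
Qed.

Lemma analytic_scale phi (u : R[i]) : analytic_on_disk phi -> normc u <= 1 ->
  analytic_on_disk (fun z => phi (u * z)).
Proof.
move=> phiA u1 z /unit_diskE z1.
have /phiA/cderiv_derive1 H : unit_disk (u * z).
  by apply/unit_diskE; rewrite normcM (le_lt_trans _ z1) // ler_piMl ?normc_ge0.
have Hu := cderivZ u (cderiv_id z).
by have /cderivP[] := @cderiv_comp _ phi (fun z => u * z) _ _ _ H Hu.
Qed.

Lemma taylor_coef_scale (u : R[i]) :
  taylor_coef (fun z : R[i] => u * z) 1 = u /\
  taylor_coef (fun z : R[i] => u * z) 2 = 0.
Proof.
have d1 : derive1 (fun z : R[i] => u * z) = fun=> u.
  apply/funext => z; apply: derive1_cderiv.
  by have := cderivZ u (cderiv_id z); rewrite mulr1.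
rewrite /taylor_coef derive1n1 derive1nS derive1n1 d1 divr1.
by rewrite (derive1_cderiv (cderiv_cst u 0)) mul0r.
Qed.

End ToeplitzBound.

Theorem theorem2p1 (R : realType) (phi : R[i] -> R[i]) (B1 B2 : R[i])
  (phi_analytic : analytic_on_disk phi)
  (phi_univalent : univalent_on_disk phi)
  (phi_Re_gt0 : forall z : R[i], unit_disk z -> 0 < complex.Re (phi z))
  (phi0 : phi 0 = 1)
  (dphi0_gt0 : 0 < derive1 phi 0)
  (ddphi0_real : derive1n 2 phi 0 \is Num.real)
  (B1E : B1 = taylor_coef phi 1)
  (B2E : B2 = taylor_coef phi 2)
  (B1_gt0 : 0 < B1)
  (B1_le : B1 <= `|B2 + B1 ^+ 2|) :
  (forall f : R[i] -> R[i], class_Sstar phi f ->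
     `|toeplitz_det f 2 2| <= 4^-1 * (B2 + B1 ^+ 2) ^+ 2 + B1 ^+ 2) /\
  (exists2 f : R[i] -> R[i], class_Sstar phi f &
     `|toeplitz_det f 2 2| = 4^-1 * (B2 + B1 ^+ 2) ^+ 2 + B1 ^+ 2).
Proof.
have [b1 b1E] : exists b : R, B1 = b%:C.
  by apply/complex_realP; rewrite realE ltW.
have [b2 b2E] : exists b : R, B2 = b%:C.
  apply/complex_realP; rewrite B2E /taylor_coef rpredM // rpredV.
  exact: realn.
pose k := b2 + b1 ^+ 2; have kE : B2 + B1 ^+ 2 = k%:C.
  by rewrite b1E b2E /k rmorphD rmorphXn.
have valE : 4^-1 * (B2 + B1 ^+ 2) ^+ 2 + B1 ^+ 2 = (k ^+ 2 / 4 + b1 ^+ 2)%:C.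
  rewrite kE b1E -!rmorphXn -(rmorph_nat (real_complex R)) -fmorphV -rmorphM.
  by rewrite -rmorphD mulrC.
have b1_gt0 : 0 < b1 by move: B1_gt0; rewrite b1E ltr0c.
have b1k : b1 <= `|k| by move: B1_le; rewrite kE b1E normr_normc normc_real lecR.
rewrite valE; split.
  move=> f [fS [w [wA wD w0 fw]]].
  have [a2E a3E] := Sstar_coef phi_analytic phi0 wA wD w0 fS fw.
  have := schwarz_coef wA wD w0.
  move: a2E a3E; rewrite -B1E -B2E toeplitz_det22.
  move: (taylor_coef f 2) (taylor_coef f 3) (taylor_coef w 1) (taylor_coef w 2).
  move=> a2 a3 c1 c2 a2E a3E c21.
  have c11 : normc c1 ^+ 2 <= 1 by have := normc_ge0 c2; lra.
  have k0 := normr_ge0 k.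
  have A3 : 2 * normc a3 <= `|k|.
    rewrite -(normc_nat R 2) -normcM a3E a2E.
    have -> : (B1 * c1) ^+ 2 + (B1 * c2 + B2 * c1 ^+ 2) = b1%:C * c2 + k%:C * c1 ^+ 2.
      by rewrite -kE -b1E; ring.
    rewrite (le_trans (ler_normcD _ _)) // !normcM !normc_real (gtr0_norm b1_gt0) -expr2.
    (* B1 |c2| <= |k| (1 - |c1|^2), which adds up with |k| |c1|^2 to |k|. *)
    have := ler_pM (ltW b1_gt0) (normc_ge0 c2) b1k c21; lra.
  have A2 : normc a2 ^+ 2 <= b1 ^+ 2.
    by rewrite a2E normcM b1E normc_real exprMn real_normK ?num_real // ler_piMr // sqr_ge0.
  rewrite normr_normc lecR (le_trans (ler_normcB _ _)) // !normcX addrC lerD //.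
  have A3' : (2 * normc a3) ^+ 2 <= `|k| ^+ 2.
    by rewrite lerXn2r ?nnegrE ?mulr_ge0 ?normc_ge0.
  by move: A3'; rewrite real_normK ?num_real // exprMn; lra.
pose p z := phi ('i * z : R[i]).
have ni : normc ('i : R[i]) = 1 by rewrite /normc /= expr0n add0r expr1n sqrtr1.
have iD z : unit_disk z -> unit_disk ('i * z : R[i]).
  by rewrite !unit_diskE normcM ni mul1r.
have pA : analytic_on_disk p by apply: analytic_scale; rewrite ?ni.
have p0 : p 0 = 1 by rewrite /p mulr0.
have fS := Sstar_fun_S pA p0 (fun z zD => phi_Re_gt0 _ (iD z zD)).
have fq z : unit_disk z -> starlike_quotient (Sstar_fun p) z = phi ('i * z).
  exact: Sstar_fun_quotient.
have wA : analytic_on_disk (fun z : R[i] => 'i * z).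
  by move=> z _; have /cderivP[] := cderivZ ('i : R[i]) (cderiv_id z).
exists (Sstar_fun p).
  by split=> //; exists (fun z => 'i * z); split; rewrite ?mulr0.
have [a2E a3E] := Sstar_coef phi_analytic phi0 wA iD (mulr0 _) fS fq.
have [w1 w2] := taylor_coef_scale ('i : R[i]).
move: a2E a3E; rewrite toeplitz_det22 -B1E -B2E w1 w2.
move: (taylor_coef _ 2) (taylor_coef _ 3) => a2 a3 a2E a3E.
have i2 : ('i : R[i]) ^+ 2 = -1 by exact: sqr_i.
have a22 : a2 ^+ 2 = - B1 ^+ 2 by rewrite a2E exprMn i2 mulrN1.
have a33 : a3 = - (k%:C / 2).
  have n2 : (2 : R[i]) != 0 by rewrite pnatr_eq0.
  by apply: (mulfI n2); rewrite a3E a22 i2 -kE; field.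
(* Here a2^2 = - B1^2 and a3^2 = k^2 / 4, so the two terms of the determinant have the same sign and
   their moduli add. *)
rewrite (_ : _ - _ = - (k ^+ 2 / 4 + b1 ^+ 2)%:C).
  rewrite normrN normr_normc normc_real ger0_norm //.
  by rewrite addr_ge0 ?divr_ge0 ?sqr_ge0.
by rewrite -valE a22 a33 -kE; field.
Qed.
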